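(* There is an algorithm for adaptive alphabetic prefix-free coding, using no data structure more complicated than a lookup table, such that, given a string $S[1..n]$ over the alphabet $\{1,\ldots,\sigma\}$ with $\sigma = o(n^{1/2}/\log n)$, it encodes $S$ in at most $n(H+2)+o(n)$ bits, where $H$ is the empirical entropy of $S$, and both encoding and decoding $S$ take $O(n)$ time.
   Context: Adaptive prefix-free coding: the string $S[1..n]$ is encoded one character at a time. For each position $j$, the character $S[j]$ is encoded by its codeword in a prefix-free binary code over $\{1,\ldots,\sigma\}$ that is determined only by $S[1..j-1]$ (together with the known parameters $n$ and $\sigma$), so that a decoder who has already recovered $S[1..j-1]$ knows the same code and can decode $S[j]$. The encoding of $S$ is the concatenation of these codewords. It is alphabetic if every code used is alphabetic, i.e., for characters $a<b$ the codeword of $a$ is lexicographically smaller than the codeword of $b$ (so the lexicographic order of encodings agrees with that of the encoded strings). The empirical entropy of $S$ is $H = \sum_{i=1}^{\sigma} \frac{\mathrm{occ}_i(S)}{n} \lg \frac{n}{\mathrm{occ}_i(S)}$, where $\mathrm{occ}_i(S)$ is the number of occurrences of character $i$ in $S$, terms with $\mathrm{occ}_i(S)=0$ are taken to be $0$, and $\lg$ is the base-2 logarithm. The model of computation is the word RAM with $\Omega(\log n)$-bit words. Asymptotic notation is with respect to $n \to \infty$. *)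

(* Defs.v *)
From HB Require Import structures.
From mathcomp Require Import all_boot all_order all_algebra.
From mathcomp Require Import all_classical all_reals all_analysis.

Set Implicit Arguments.
Unset Strict Implicit.
Unset Printing Implicit Defensive.

Import Order.TTheory GRing.Theory Num.Theory.

(** * Adaptive alphabetic prefix-free coding

    The alphabet {1, ..., sigma} is represented by ['I_sigma]: the ordinal [a]
    stands for the character [a.+1]. *)

Definition prefix_free (sigma : nat) (c : 'I_sigma -> bitseq) : Prop :=
  forall a b : 'I_sigma, a != b -> ~~ prefix (c a) (c b).

(** [seqlexi bool] carries the lexicographic order, with [false < true]. *)
Definition alphabetic (sigma : nat) (c : 'I_sigma -> bitseq) : Prop :=
  forall a b : 'I_sigma, a < b -> ((c a : seqlexi bool) < (c b : seqlexi bool))%O.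

(** [A n sigma p] is the code used for the character that follows the prefix
    [p] in a string of length [n]; that the code depends only on the preceding
    characters and on [n] and [sigma] is enforced by this type. *)
Definition adaptive_coder : Type :=
  forall (n sigma : nat), seq 'I_sigma -> 'I_sigma -> bitseq.

Definition adaptive_alphabetic_prefix_free (A : adaptive_coder) : Prop :=
  forall (n sigma : nat) (p : seq 'I_sigma), size p < n ->
    prefix_free (A n sigma p) /\ alphabetic (A n sigma p).

Definition encoding (A : adaptive_coder) (n sigma : nat)
    (S : n.-tuple 'I_sigma) : bitseq :=
  flatten [seq A n sigma (take j S) (tnth S j) | j : 'I_n].

Section Entropy.
Local Open Scope ring_scope.

Definition lg (R : realType) (x : R) : R := ln x / ln 2.

(** Since [0 / x = 0], the characters that do not occur contribute [0]. *)
Definition empirical_entropy (R : realType) (n sigma : nat)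
    (S : n.-tuple 'I_sigma) : R :=
  \sum_(a < sigma)
    (count_mem a S)%:R / n%:R * lg (n%:R / (count_mem a S)%:R).

End Entropy.

(** * Word RAM with lookup tables

    Words are the natural numbers below [2 ^ w], where [w] is the word size.
    The only storage consists of scalar registers and of lookup tables (flat
    arrays of words indexed by words).  Register and table names are literals
    of the program, so a program uses a fixed finite number of each, and it
    can neither allocate memory nor point to a table or a register.  Interleaving
    the tables in a single memory gives the usual word RAM, up to a constant
    factor in the running time. *)

Inductive binop : Type :=
  Add | Sub | Mul | Div | Mod | Shl | Shr | And | Or | Xor | Lt | Eq.

Inductive expr : Type :=
  | Lit of nat
  | Reg of nat
  | Look of nat & expr
  | Bin of binop & expr & expr.

(** [Assign x e] assigns to register [x]; [Store t i e] writes the value of [e] at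
    index [i] of table [t].  Conditions hold when they are nonzero. *)
Inductive cmd : Type :=
  | Skip
  | Assign of nat & expr
  | Store of nat & expr & expr
  | Seq of cmd & cmd
  | Ite of expr & cmd & cmd
  | While of expr & cmd.

Record state : Type := State {
  reg : nat -> nat;
  tab : nat -> nat -> nat
}.

(** All results are truncated to [w] bits; in particular [Add], [Sub] and [Mul]
    are modular.  Division by [0] yields [0]. *)
Definition binop_sem (w : nat) (o : binop) (x y : nat) : nat :=
  match o with
  | Add => x + y
  | Sub => x + (2 ^ w - y)
  | Mul => x * y
  | Div => x %/ y
  | Mod => x %% y
  | Shl => x * 2 ^ y
  | Shr => x %/ 2 ^ y
  | And => Nat.land x y
  | Or => Nat.lor x y
  | Xor => Nat.lxor x y
  | Lt => x < y
  | Eq => x == y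
  end %% 2 ^ w.

Fixpoint eval (w : nat) (s : state) (e : expr) : nat :=
  match e with
  | Lit k => k %% 2 ^ w
  | Reg x => reg s x
  | Look t i => tab s t (eval w s i)
  | Bin o e1 e2 => binop_sem w o (eval w s e1) (eval w s e2)
  end.

(** Every operation, register access and table access takes unit time. *)
Fixpoint cost (e : expr) : nat :=
  match e with
  | Lit _ | Reg _ => 1
  | Look _ i => (cost i).+1
  | Bin _ e1 e2 => (cost e1 + cost e2).+1
  end.

Definition set_reg (s : state) (x v : nat) : state :=
  State [eta reg s with x |-> v] (tab s).

Definition set_tab (s : state) (t i v : nat) : state :=
  State (reg s)
        (fun t' i' => if (t' == t) && (i' == i) then v else tab s t' i').

(** [exec w c s s' k]: on words of [w] bits, the (deterministic) program [c]
    started in [s] halts in [s'] after [k] units of time. *)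
Inductive exec (w : nat) : cmd -> state -> state -> nat -> Prop :=
  | ExecSkip s : exec w Skip s s 1
  | ExecAssign s x e :
      exec w (Assign x e) s (set_reg s x (eval w s e)) (cost e).+1
  | ExecStore s t i e :
      exec w (Store t i e) s (set_tab s t (eval w s i) (eval w s e))
           (cost i + cost e).+1
  | ExecSeq c1 c2 s s1 s2 k1 k2 :
      exec w c1 s s1 k1 -> exec w c2 s1 s2 k2 ->
      exec w (Seq c1 c2) s s2 (k1 + k2)
  | ExecIteT e c1 c2 s s' k :
      eval w s e != 0 -> exec w c1 s s' k ->
      exec w (Ite e c1 c2) s s' (cost e + k).+1
  | ExecIteF e c1 c2 s s' k :
      eval w s e = 0 -> exec w c2 s s' k ->
      exec w (Ite e c1 c2) s s' (cost e + k).+1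
  | ExecWhileT e c s s1 s2 k1 k2 :
      eval w s e != 0 -> exec w c s s1 k1 -> exec w (While e c) s1 s2 k2 ->
      exec w (While e c) s s2 (cost e + k1 + k2).+1
  | ExecWhileF e c s :
      eval w s e = 0 -> exec w (While e c) s s (cost e).+1.

(** * Input and output

    Registers 0, 1 and 2 initially hold [n], [sigma] and [w], and table 0 holds
    the input; everything else is zero.  The output is left in table 1. *)

Definition init_state (w n sigma : nat) (input : nat -> nat) : state :=
  State (fun x => nth 0 [:: n; sigma; w] x)
        (fun t i => if t == 0 then input i else 0).

(** One character per word. *)
Definition string_table (n sigma : nat) (S : n.-tuple 'I_sigma) : nat -> nat :=
  fun j => nth 0 [seq (val a).+1 | a : 'I_sigma <- S] j.

(** A bit string packed [w] bits to a word, most significant bit first, the last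
    word being padded with zeros. *)
Definition packed (w : nat) (b : bitseq) : nat -> nat :=
  fun i => \sum_(k < w) nth false b (i * w + k) * 2 ^ (w - k.+1).

(** Within time [T], [c] outputs the bit string [b], packed, on input [S], and
    leaves its length in register 0. *)
Definition encodes_within (w : nat) (c : cmd) (n sigma : nat)
    (S : n.-tuple 'I_sigma) (b : bitseq) (T : nat) : Prop :=
  exists (s : state) (k : nat),
    [/\ exec w c (init_state w n sigma (string_table S)) s k,
        k <= T,
        reg s 0 = size b
      & forall i, i * w < size b -> tab s 1 i = packed w b i].

(** The decoder is told [n] and [sigma], but not the length of [b]. *)
Definition decodes_within (w : nat) (c : cmd) (n sigma : nat)
    (b : bitseq) (S : n.-tuple 'I_sigma) (T : nat) : Prop :=
  exists (s : state) (k : nat),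
    [/\ exec w c (init_state w n sigma (packed w b)) s k,
        k <= T
      & forall j, j < n -> tab s 1 j = string_table S j].

(** Number of bits in the binary representation of [m] (1 for [m = 0]). *)
Definition bit_length (m : nat) : nat := (trunc_log 2 m).+1.

(** Words of Omega(log n) bits: the word size is at least [c] times the number
    of bits needed for [n] and [sigma].  When [sigma <= n] eventually, this is
    a lower bound of the form [w >= c' * log n]; adding [sigma] makes sure that
    characters fit in a word in the remaining cases too. *)
Definition word_size_ok (c w n sigma : nat) : Prop :=
  c * bit_length (n + sigma) <= w.

(* Main.v *)
(* Cut S into blocks of length M, a power of 2 of order sqrt n with M >= 4 sigma.  At the start
   of a block reached after t characters, character a receives the weight
   g_a = 2 + floor((M - 2 sigma) occ_a / t); the weights add up to at most M, so they cut [0, M)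
   into consecutive cells.  A cell of size g contains an aligned dyadic interval of size 2^e > g / 4,
   and the codeword of a, of length lg M - e < lg (M / g_a) + 2, names that interval; disjointness
   and order of the intervals make the code prefix-free and alphabetic.  A table of M entries,
   refilled in O(M) time once per block, decodes a character from the next lg M bits.

   Using counts that are up to M characters old, the encoding pays for the i-th occurrence of a
   at position j at most lg j - lg i, plus lg i - lg (i - M) for staleness.  By convexity of
   x lg x the former is bounded by the increment of the potential j lg j - sum_a i_a lg i_a,
   which ends at n H, and the latter telescopes to M lg n for each character.  The total
   overhead is O(sigma M log n), which is o(n) when sigma = o(sqrt n / log n). *)

Require Import Defs.
From mathcomp Require Import all_boot all_order all_algebra.
From mathcomp Require Import all_classical all_reals all_analysis.
From mathcomp Require Import zify ring lra.
Import Order.TTheory GRing.Theory Num.Theory.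
Import numFieldNormedType.Exports.
Local Open Scope classical_set_scope.
Local Open Scope ring_scope.

Set Implicit Arguments.
Unset Strict Implicit.
Unset Printing Implicit Defensive.

(** * Bit windows and packed words *)

Section Windows.
Local Open Scope nat_scope.

(** Big-endian value of [l] bits of a stream from position [s]. Taking a total function
    [nat -> bool] builds in the zero padding of [packed] and makes reading past the end of an
    encoding harmless. *)
Definition window (f : nat -> bool) (s l : nat) : nat :=
  \sum_(k < l) f (s + k) * 2 ^ (l - k.+1).

Lemma eq_window f f' s s' l :
  (forall k, k < l -> f (s + k) = f' (s' + k)) -> window f s l = window f' s' l.
Proof. by move=> H; apply: eq_bigr => k _; rewrite H. Qed.

Lemma window0 f s : window f s 0 = 0.
Proof. by rewrite /window big_ord0. Qed.

Lemma window_cat f s l1 l2 :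
  window f s (l1 + l2) = window f s l1 * 2 ^ l2 + window f (s + l1) l2.
Proof.
rewrite /window big_split_ord /= big_distrl /=; congr (_ + _).
  apply: eq_bigr => k _; rewrite -mulnA -expnD; congr (_ * 2 ^ _).
  by have := ltn_ord k; lia.
by apply: eq_bigr => k _; rewrite addnA; congr (_ * 2 ^ _); lia.
Qed.

Lemma window_false f s l : (forall k, k < l -> f (s + k) = false) -> window f s l = 0.
Proof. by move=> H; apply: big1 => k _; rewrite H. Qed.

Lemma window1 f s : window f s 1 = f s.
Proof. by rewrite /window big_ord1 addn0 muln1. Qed.

Lemma windowS f s l : window f s l.+1 = window f s l * 2 + f (s + l).
Proof. by rewrite -addn1 window_cat window1 expn1. Qed.

Lemma window_lt f s l : window f s l < 2 ^ l.
Proof.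
elim: l => [|l IH]; first by rewrite window0.
rewrite windowS expnS.
by case: (f _) => /=; lia.
Qed.

Lemma window_div f s l1 l2 : window f s (l1 + l2) %/ 2 ^ l2 = window f s l1.
Proof.
by rewrite window_cat divnMDl ?expn_gt0// divn_small ?addn0// window_lt.
Qed.

Lemma window_mod f s l1 l2 : window f s (l1 + l2) %% 2 ^ l2 = window f (s + l1) l2.
Proof. by rewrite window_cat modnMDl modn_small// window_lt. Qed.

Lemma packedE w b i : packed w b i = window (nth false b) (i * w) w.
Proof. by []. Qed.

(** The truncated left shift discards the bits before [pos] in the first word. If the [L] bits fit
    into that word, the right shift of the next word is by at least [w] and yields 0; otherwise it
    leaves exactly the missing low bits. *)
Lemma window_read f w L pos : L <= w -> 0 < w ->
  ((window f (pos %/ w * w) w * 2 ^ (pos %% w) %% 2 ^ w) %/ 2 ^ (w - L)) +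
  window f ((pos %/ w).+1 * w) w %/ 2 ^ ((w - pos %% w) + (w - L)) =
  window f pos L.
Proof.
move=> Lw w0.
have := divn_eq pos w; have := ltn_pmod pos w0.
set q := pos %/ w; set r := pos %% w => rw posE.
have -> : window f (q * w) w * 2 ^ r %% 2 ^ w = window f pos (w - r) * 2 ^ r.
  have wE : w = r + (w - r) by lia.
  rewrite [X in window f _ X]wE window_cat -posE mulnDl -mulnA -expnD.
  rewrite [w - r + r]subnK; last exact: ltnW.
  rewrite modnMDl modn_small// -[X in _ < 2 ^ X](subnK (ltnW rw)).
  by rewrite expnD ltn_pmul2r ?expn_gt0// window_lt.
case: (leqP (r + L) w) => rL.
  rewrite [X in _ + X]divn_small ?addn0; last first.
    by apply: leq_trans (window_lt _ _ _) _; rewrite leq_pexp2l//; lia.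
  have -> : w - L = (w - r - L) + r by lia.
  rewrite expnD divnMr ?expn_gt0//.
  have wrE : w - r = L + (w - r - L) by lia.
  by rewrite [X in window _ _ X]wrE window_div.
have -> : r = (r + L - w) + (w - L) by lia.
rewrite [2 ^ (_ + (w - L))]expnD mulnA mulnK ?expn_gt0//.
have -> : r + L - w + (w - L) = r by lia.
have E : w = (r + L - w) + ((w - r) + (w - L)) by lia.
rewrite [X in window f (_ * _) X]E window_div.
have -> : q.+1 * w = pos + (w - r) by rewrite mulSn posE; lia.
by rewrite -window_cat; congr window; lia.
Qed.

Lemma nth_packed0 w b i : size b <= i * w -> packed w b i = 0.
Proof.
by move=> H; apply: window_false => k kw; rewrite nth_default//; lia.
Qed.

(* Appending a codeword [c] touches two words only; the truncation of the left shift and the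
   vanishing of right shifts by [w] or more make the formula uniform in whether
   [c] straddles the boundary. *)
Lemma packed_cat w b c i : size c <= w -> 0 < w ->
  let v := window (nth false c) 0 (size c) in
  let q := size b %/ w in let r := size b %% w in
  packed w (b ++ c) i =
    if i == q then packed w b q + v * 2 ^ (w - size c) %/ 2 ^ r
    else if i == q.+1 then
      packed w b q.+1 + v * 2 ^ ((w - r) + (w - size c)) %% 2 ^ w
    else packed w b i.
Proof.
move=> cw w0 v q r.
have posE : size b = q * w + r := divn_eq (size b) w.
have rw : r < w := ltn_pmod _ w0.
set f' := nth false (b ++ c); set f := nth false b.
have fE k : k < size b -> f' k = f k by move=> kb; rewrite /f' nth_cat kb.
have vE l : window f' (size b) (size c + l) = v * 2 ^ l.
  rewrite window_cat [X in _ + X]window_false ?addn0.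
    congr (_ * _); apply: eq_window => k kc.
    by rewrite /f' nth_cat; case: ltnP => [|_]; [lia|rewrite addKn add0n].
  by move=> k kl; rewrite /f' nth_default// size_cat; lia.
have [->|iq] := eqVneq i q.
  have wE : w = r + (w - r) by lia.
  rewrite !packedE -/f' -/f [X in window f' (q * w) X]wE [X in window f (q * w) X]wE.
  rewrite !window_cat -posE [X in _ = _ + X + _](@window_false f) ?addn0; last first.
    by move=> k kl; rewrite /f nth_default//; lia.
  congr (_ * _ + _).
    by apply: eq_window => k kr; apply: fE; rewrite posE; lia.
  rewrite -vE subnKC//.
  by rewrite -[w in RHS](subnK (ltnW rw)) window_div.
have [->|iq1] := eqVneq i q.+1.
  rewrite (@nth_packed0 w b) ?mulSn; last by rewrite posE; lia.
  rewrite packedE add0n -/f'.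
  have -> : (w - r) + (w - size c) = (w - size c) + (w - r) by lia.
  case: (leqP (size c + (w - size c) + (w - r)) w) => H; last first.
    rewrite -vE addnA subnKC// addnC window_mod; congr window.
    by rewrite mulSn posE; lia.
  rewrite -vE addnA subnKC// addnC window_mod; congr window.
  by rewrite mulSn posE; lia.
rewrite !packedE -/f -/f'.
case: (ltnP i q) => H.
  apply: eq_window => k kw; apply: fE; rewrite posE.
  suff : i.+1 * w <= q * w by rewrite mulSn; lia.
  by rewrite leq_mul2r H orbT.
have : q.+2 * w <= i * w by rewrite leq_mul2r; apply/orP; right; lia.
rewrite !mulSn => H'.
rewrite !window_false// => k kw; rewrite /f' /f nth_default// ?size_cat; lia.
Qed.

Fixpoint bits (l x : nat) : bitseq :=
  if l is l'.+1 then rcons (bits l' x./2) (odd x) else [::].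

Lemma size_bits l x : size (bits l x) = l.
Proof. by elim: l x => //= l IH x; rewrite size_rcons IH. Qed.

Lemma window_bits l x : x < 2 ^ l -> window (nth false (bits l x)) 0 l = x.
Proof.
elim: l x => [|l IH] x /=; first by rewrite window0; case: x.
rewrite expnS => H; rewrite windowS add0n.
rewrite nth_rcons size_bits ltnn eqxx.
rewrite (@eq_window _ (nth false (bits l x./2)) 0 0); last first.
  by move=> k kl; rewrite !add0n nth_rcons size_bits kl.
by rewrite IH; [rewrite muln2 addnC odd_double_half|lia].
Qed.

Lemma window_cons x u : window (nth false (x :: u)) 0 (size u).+1 =
  x * 2 ^ size u + window (nth false u) 0 (size u).
Proof.
by rewrite -add1n window_cat window1; congr (_ + _); apply: eq_window.
Qed.

(* The hypothesis says that the dyadic interval of [u] ends no later than that of [v] starts. *)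
Lemma dyadic_lexi (u v : bitseq) :
  ((window (nth false u) 0 (size u)).+1) * 2 ^ size v <=
    window (nth false v) 0 (size v) * 2 ^ size u ->
  [/\ ((u : seqlexi bool) < (v : seqlexi bool))%O, ~~ prefix u v & ~~ prefix v u].
Proof.
elim: u v => [|x u IH] [|y v].
- by rewrite /= !window0.
- rewrite window0 !muln1 mul1n => H.
  by have := window_lt (nth false (y :: v)) 0 (size (y :: v)); lia.
- rewrite window0 mul0n => H.
  by exfalso; move: H; apply/negP; rewrite -ltnNge muln1.
rewrite /= !window_cons => H.
have [E|N] := eqVneq x y.
  have /IH [lt p1 p2] : (window (nth false u) 0 (size u)).+1 * 2 ^ size v <=
      window (nth false v) 0 (size v) * 2 ^ size u.
    by rewrite E !expnS in H; nia.
  by split; rewrite ?E // ltxi_cons lexx.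
have ul := window_lt (nth false u) 0 (size u).
have vl := window_lt (nth false v) 0 (size v).
case: x y N H => [] [] //= _ H.
exfalso; move: H; rewrite !expnS; nia.
Qed.

End Windows.

(** * The code of a block *)

Section Code.
Local Open Scope nat_scope.

(** Halving the logarithm, rounded up, gives the least exponent whose power of 2 has square at least
    [n + 16 sigma^2]; the second summand forces [M >= 4 sigma]. *)
Definition loglen (n sigma : nat) : nat := uphalf (up_log 2 (n + 16 * (sigma * sigma))).

Definition blocklen (n sigma : nat) : nat := 2 ^ loglen n sigma.

Lemma blocklen_sq n sigma :
  n + 16 * (sigma * sigma) <= blocklen n sigma * blocklen n sigma.
Proof.
rewrite /blocklen /loglen -expnD addnn; set m := n + _.
apply: (leq_trans (up_logP m (isT : 1 < 2))); rewrite leq_exp2l//.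
by rewrite uphalf_half doubleD -[X in X <= _]odd_double_half; lia.
Qed.

Lemma loglen_min n sigma l : l < loglen n sigma ->
  2 ^ l * 2 ^ l < n + 16 * (sigma * sigma).
Proof.
move=> ll; rewrite -expnD addnn ltnNge; apply/negP => /(up_log_min (isT : 1 < 2)) H.
by move: ll; rewrite /loglen; set u := up_log _ _ in H *; rewrite uphalf_half; lia.
Qed.

(** Minimality bounds the square of half the block length; the [+ 1] covers block length 1. *)
Lemma blocklen_sq_le n sigma :
  blocklen n sigma * blocklen n sigma <= 4 * n + 64 * (sigma * sigma) + 1.
Proof.
rewrite /blocklen; have := @loglen_min n sigma.
case: (loglen n sigma) => [|l] H; first by rewrite expn0; lia.
by have := H l (ltnSn l); rewrite expnS; lia.
Qed.

Lemma blocklen_gt0 n sigma : 0 < blocklen n sigma.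
Proof. by rewrite expn_gt0. Qed.

Lemma blocklen_alphabet n sigma : 4 * sigma <= blocklen n sigma.
Proof. by have := blocklen_sq n sigma; nia. Qed.

Lemma blocklen_linear n sigma : blocklen n sigma <= 2 * n + 8 * sigma + 1.
Proof. by have := blocklen_sq_le n sigma; nia. Qed.

Lemma loglen_le n sigma : loglen n sigma <= blocklen n sigma.
Proof. by apply: ltnW; apply: ltn_expl. Qed.

(* Characters split [0, blocklen) into cells [cumul i, cumul i + weight i); the constant 2 keeps
   every cell large enough to contain an aligned dyadic interval, and [x %/ 0 = 0] makes
   all weights equal in the first block. *)
Definition weight (n sigma : nat) (q : seq nat) (i : nat) : nat :=
  2 + (blocklen n sigma - 2 * sigma) * count_mem i q %/ size q.

Definition cumul n sigma q i : nat := \sum_(k < i) weight n sigma q k.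

Definition cellexp n sigma q i : nat := (trunc_log 2 (weight n sigma q i)).-1.

Definition codelen n sigma q i : nat := loglen n sigma - cellexp n sigma q i.

(* The codeword of [i] is the first aligned interval of length [2 ^ cellexp] starting in its
   cell; it ends within the cell because [2 * 2 ^ cellexp <= weight]. *)
Definition codeval n sigma q i : nat :=
  (cumul n sigma q i + (2 ^ cellexp n sigma q i).-1) %/ 2 ^ cellexp n sigma q i.

Definition codeword n sigma q i : bitseq :=
  bits (codelen n sigma q i) (codeval n sigma q i).

(* The code used at position [j] is the one for the counts at the start of the block of [j]. *)
Definition stale n sigma (j : nat) : nat := j %/ blocklen n sigma * blocklen n sigma.

Section Fixed.
Variables (n sigma : nat) (q : seq nat).
Hypothesis qs : all (gtn sigma) q.

Lemma sum_count_mem : \sum_(i < sigma) count_mem (i : nat) q = size q.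
Proof.
elim: q qs => [|x s IH] /=; first by rewrite big1.
move=> /andP[xs /IH H]; rewrite big_split /= H.
rewrite (bigD1 (Ordinal xs)) //= eqxx big1 ?addn0//.
by move=> k; rewrite -val_eqE /= eq_sym => /negPf ->.
Qed.

Lemma cumulS i : cumul n sigma q i.+1 = cumul n sigma q i + weight n sigma q i.
Proof. by rewrite /cumul big_ord_recr. Qed.

Lemma cumul_mono i j : i <= j -> cumul n sigma q i <= cumul n sigma q j.
Proof.
move=> /subnKC <-; elim: (j - i) => [|d IH]; first by rewrite addn0.
by rewrite addnS cumulS; lia.
Qed.

(** Counts sum to [size q] and flooring only loses, so the proportional parts take at most
    [M - 2 sigma]; the constants 2 take the remaining [2 sigma]. *)
Lemma cumul_le : cumul n sigma q sigma <= blocklen n sigma.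
Proof.
rewrite /cumul /weight big_split /= sum_nat_const card_ord.
set D := _ - _.
have : \sum_(k < sigma) D * count_mem (k : nat) q %/ size q <= D.
  case: (posnP (size q)) => [->|q0].
    by rewrite big1 // => k _; rewrite divn0.
  have DE : D * size q = \sum_(k < sigma) D * count_mem (k : nat) q.
    by rewrite -sum_count_mem big_distrr.
  apply: (@leq_trans (D * size q %/ size q)); last by rewrite mulnK.
  rewrite leq_divRL// DE big_distrl /=.
  by apply: leq_sum => k _; exact: leq_divM.
have := blocklen_alphabet n sigma; rewrite /D.
by move: (\sum_(k < sigma) _) => x; lia.
Qed.

Lemma weight_ge2 i : 2 <= weight n sigma q i. Proof. by []. Qed.

Lemma cumul_le_block i : i <= sigma -> cumul n sigma q i <= blocklen n sigma.
Proof. by move=> /cumul_mono /leq_trans; apply; exact: cumul_le. Qed.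

Lemma weight_le i : i < sigma -> weight n sigma q i <= blocklen n sigma.
Proof. by move=> /cumul_le_block; rewrite cumulS; lia. Qed.

(** As the weight is at least 2, its truncated logarithm is positive, so the predecessor in
    [cellexp] really halves the power of 2. *)
Lemma cellexpP i :
  2 * 2 ^ cellexp n sigma q i <= weight n sigma q i < 4 * 2 ^ cellexp n sigma q i.
Proof.
have w2 := weight_ge2 i; have /andP[lo hi] := trunc_log_bounds (isT : 1 < 2) (ltnW w2).
have t0 : 0 < trunc_log 2 (weight n sigma q i) by rewrite trunc_log_gt0.
by move: lo hi; rewrite /cellexp -{1 2}(prednK t0) !expnS; lia.
Qed.

Lemma cellexp_lt i : i < sigma -> cellexp n sigma q i < loglen n sigma.
Proof.
move=> /weight_le wl; have /andP[lo _] := cellexpP i.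
by rewrite -(@leq_exp2l 2)// expnS; exact: leq_trans lo wl.
Qed.

Lemma codeval_cell i : let e := cellexp n sigma q i in
  cumul n sigma q i <= codeval n sigma q i * 2 ^ e /\
  (codeval n sigma q i).+1 * 2 ^ e <= cumul n sigma q i.+1.
Proof.
move=> e; rewrite cumulS /codeval -/e; have /andP[lo _] := cellexpP i.
have P0 : 0 < 2 ^ e by rewrite expn_gt0.
rewrite -/e in lo; move: (2 ^ e) P0 lo => P P0 lo.
have := divn_eq (cumul n sigma q i + P.-1) P.
have := ltn_pmod (cumul n sigma q i + P.-1) P0.
by move: (_ %/ _) (_ %% _) => u v; rewrite mulSn; lia.
Qed.

Lemma codelenK i : i < sigma -> codelen n sigma q i + cellexp n sigma q i = loglen n sigma.
Proof. by move=> /cellexp_lt; rewrite /codelen; lia. Qed.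

Lemma codeval_lt i : i < sigma -> codeval n sigma q i < 2 ^ codelen n sigma q i.
Proof.
move=> si; have [_ hi] := codeval_cell i.
rewrite -(@leq_pmul2r (2 ^ cellexp n sigma q i)) ?expn_gt0//.
rewrite -expnD codelenK//; apply: leq_trans hi _; exact: cumul_le_block.
Qed.

Lemma codeword_ordered i j : i < j -> j < sigma ->
  [/\ ((codeword n sigma q i : seqlexi bool) < (codeword n sigma q j : seqlexi bool))%O,
   ~~ prefix (codeword n sigma q i) (codeword n sigma q j) &
   ~~ prefix (codeword n sigma q j) (codeword n sigma q i)].
Proof.
move=> ij js; have si := ltn_trans ij js; apply: dyadic_lexi.
rewrite !size_bits !window_bits ?codeval_lt//.
set ei := cellexp n sigma q i; set ej := cellexp n sigma q j.
(* This factor brings both codewords to the scale of [[0, M)], up to a common factor [M], where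
   their intervals are compared through the cell boundaries. *)
rewrite -(@leq_pmul2r (2 ^ (ei + ej))) ?expn_gt0//.
have Ei : 2 ^ codelen n sigma q j * 2 ^ (ei + ej) = 2 ^ ei * blocklen n sigma.
  by rewrite -expnD [ei + ej]addnC addnA codelenK// expnD mulnC.
have Ej : 2 ^ codelen n sigma q i * 2 ^ (ei + ej) = 2 ^ ej * blocklen n sigma.
  by rewrite -expnD addnA codelenK// expnD mulnC.
rewrite -!mulnA Ei Ej !mulnA leq_mul2r; apply/orP; right.
have [_ hi] := codeval_cell i; have [lo _] := codeval_cell j.
by apply: leq_trans hi _; apply: leq_trans lo; exact: cumul_mono.
Qed.

(* Whatever follows the codeword of [i], reading [loglen] bits yields an index in the cell of [i]. *)
Lemma codeword_lookup f s i : i < sigma ->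
  window f s (codelen n sigma q i) = codeval n sigma q i ->
  cumul n sigma q i <= window f s (loglen n sigma) < cumul n sigma q i.+1.
Proof.
move=> si E; rewrite -(codelenK si) window_cat E.
have [lo hi] := codeval_cell i.
by have := window_lt f (s + codelen n sigma q i) (cellexp n sigma q i); lia.
Qed.

End Fixed.

Definition block_coder : adaptive_coder := fun n sigma p a =>
  codeword n sigma (take (stale n sigma (size p)) (map val p)) a.

Lemma all_map_val sigma (p : seq 'I_sigma) k : all (gtn sigma) (take k (map val p)).
Proof.
apply/allP => x /mem_take /mapP [a _ ->]; exact: ltn_ord.
Qed.

Lemma block_coder_valid : adaptive_alphabetic_prefix_free block_coder.
Proof.
move=> n sigma p _; have qs := all_map_val p (stale n sigma (size p)).
split=> a b ab; last first.
  by case: (codeword_ordered n qs ab (ltn_ord b)).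
have [lt|gt|eq] := ltngtP a b.
- by case: (codeword_ordered n qs lt (ltn_ord b)).
- by case: (codeword_ordered n qs gt (ltn_ord a)).
- by move: ab; rewrite -val_eqE /= eq eqxx.
Qed.

(** Incremental form of [encoding] over plain lists, so that loop invariants can speak of the first
    [j] codewords. *)
Definition encode_upto n sigma (s : seq nat) (j : nat) : bitseq :=
  flatten [seq codeword n sigma (take (stale n sigma k) s) (nth 0 s k) | k <- iota 0 j].

Lemma encode_uptoS n sigma s j : encode_upto n sigma s j.+1 =
  encode_upto n sigma s j ++ codeword n sigma (take (stale n sigma j) s) (nth 0 s j).
Proof.
by rewrite /encode_upto -addn1 iotaD map_cat flatten_cat /= cats0.
Qed.

Lemma codelen_le n sigma q i : codelen n sigma q i <= loglen n sigma.
Proof. exact: leq_subr. Qed.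

Lemma size_encode_uptoE n sigma s j : size (encode_upto n sigma s j) =
  \sum_(k < j) codelen n sigma (take (stale n sigma k) s) (nth 0 s k).
Proof.
elim: j => [|j IH]; first by rewrite big_ord0.
by rewrite encode_uptoS size_cat IH size_bits big_ord_recr.
Qed.

Lemma size_encode_upto n sigma s j : size (encode_upto n sigma s j) <= j * loglen n sigma.
Proof.
rewrite size_encode_uptoE -[X in X * _]card_ord -sum_nat_const.
by apply: leq_sum => k _; exact: codelen_le.
Qed.

Lemma encode_upto_prefix n sigma s j k : j <= k ->
  exists b, encode_upto n sigma s k = encode_upto n sigma s j ++ b.
Proof.
move=> /subnKC <-; elim: (k - j) => [|d [b Eb]].
  by exists [::]; rewrite addn0 cats0.
by rewrite addnS encode_uptoS Eb -catA; eexists.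
Qed.

Lemma encoding_block_coder n sigma (S : n.-tuple 'I_sigma) :
  encoding block_coder S = encode_upto n sigma (map val S) n.
Proof.
rewrite /encoding /encode_upto; congr flatten.
rewrite /image_mem -[iota 0 n]val_enum_ord.
rewrite -map_comp; apply: eq_map => j /=.
have jS : j < size S by rewrite size_tuple.
rewrite /block_coder size_take jS (tnth_nth (tnth S j)) (nth_map (tnth S j))//.
by rewrite map_take take_takel// /stale leq_divM.
Qed.

End Code.

(** * Program logic *)

Section ProgramLogic.
Local Open Scope nat_scope.
Variable w : nat.

(** A total-correctness triple with a time budget; the postcondition may itself be a [runs], which
    makes sequencing a plain nesting. *)
Definition runs (c : cmd) (s : state) (k : nat) (Q : state -> Prop) : Prop :=
  exists s' k', [/\ exec w c s s' k', k' <= k & Q s'].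

Lemma runs_conseq c s k k' (Q Q' : state -> Prop) :
  runs c s k Q -> k <= k' -> (forall s', Q s' -> Q' s') -> runs c s k' Q'.
Proof.
by move=> [s' [l [H lk q]]] kk' QQ'; exists s', l; split; [|exact: leq_trans kk'|exact: QQ'].
Qed.

Lemma runs_leq c s k k' Q : runs c s k Q -> k <= k' -> runs c s k' Q.
Proof. by move=> H kk'; apply: runs_conseq H kk' _. Qed.

Lemma runs_skip s (Q : state -> Prop) : Q s -> runs Skip s 1 Q.
Proof. by move=> q; exists s, 1; split => //; constructor. Qed.

Lemma runs_seq c1 c2 s k1 k2 Q :
  runs c1 s k1 (fun s1 => runs c2 s1 k2 Q) -> runs (Seq c1 c2) s (k1 + k2) Q.
Proof.
move=> [s1 [l1 [H1 L1 [s2 [l2 [H2 L2 q]]]]]]; exists s2, (l1 + l2); split => //.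
  exact: ExecSeq H1 H2.
exact: leq_add.
Qed.

Lemma runs_ite e c1 c2 s k Q :
  (Defs.eval w s e != 0 -> runs c1 s k Q) -> (Defs.eval w s e = 0 -> runs c2 s k Q) ->
  runs (Ite e c1 c2) s (cost e + k).+1 Q.
Proof.
move=> H1 H2; have [/[dup] E /H2|/[dup] E /H1] := eqVneq (Defs.eval w s e) 0.
- move=> [s' [l [H lk q]]]; exists s', (cost e + l).+1.
  by split; [apply: ExecIteF|rewrite ltnS leq_add2l|].
- move=> [s' [l [H lk q]]]; exists s', (cost e + l).+1.
  by split; [apply: ExecIteT|rewrite ltnS leq_add2l|].
Qed.

(** The budget depends on the iteration, so that rare expensive rounds can be amortized over all of
    them. *)
Lemma runs_while (I : nat -> state -> Prop) m (k : nat -> nat) e c s :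
  (forall i s, i < m -> I i s -> Defs.eval w s e != 0 /\ runs c s (k i) (I i.+1)) ->
  (forall s, I m s -> Defs.eval w s e = 0) ->
  I 0 s ->
  runs (While e c) s (\sum_(i < m) (k i + (cost e).+1) + (cost e).+1) (I m).
Proof.
move=> Hs Hm; rewrite -(big_mkord xpredT (fun i => k i + (cost e).+1)).
suff H d i s1 : i + d = m -> I i s1 ->
    runs (While e c) s1 (\sum_(i <= j < m) (k j + (cost e).+1) + (cost e).+1) (I m).
  exact: (H m 0).
elim: d i s1 => [|d IH] i s1.
  rewrite addn0 => -> Is1; exists s1, (cost e).+1.
  by rewrite big_geq//; split => //; apply: ExecWhileF; exact: Hm.
rewrite addnS -addSn => im Is1; have ltim : i < m by lia.
have [E [s2 [l2 [H2 L2 Is2]]]] := Hs i s1 ltim Is1.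
have [s3 [l3 [H3 L3 Is3]]] := IH i.+1 s2 im Is2.
exists s3, (cost e + l2 + l3).+1; split => //; first exact: ExecWhileT H2 H3.
by rewrite big_ltn//; lia.
Qed.

(* Untruncated values; only the left shift is meant to overflow. *)
Fixpoint den (s : state) (e : expr) : nat :=
  match e with
  | Lit k => k
  | Reg x => reg s x
  | Look t i => tab s t (den s i)
  | Bin o e1 e2 =>
    let x := den s e1 in let y := den s e2 in
    match o with
    | Add => x + y
    | Defs.Sub => x - y
    | Mul => x * y
    | Div => x %/ y
    | Mod => x %% y
    | Shl => (x * 2 ^ y) %% 2 ^ w
    | Shr => x %/ 2 ^ y
    | Defs.Lt => x < y
    | _ => binop_sem w o x y
    end
  end.

(** Side conditions that exclude wrap-around, so that [den] is the machine value; left shifts carry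
    none because [den] truncates them too. *)
Fixpoint safe (s : state) (e : expr) : Prop :=
  match e with
  | Lit k => k < 2 ^ w
  | Reg x => True
  | Look t i => safe s i
  | Bin o e1 e2 =>
    [/\ safe s e1, safe s e2 &
      let x := den s e1 in let y := den s e2 in
      match o with
      | Add => x + y < 2 ^ w
      | Defs.Sub => y <= x < 2 ^ w
      | Mul => x * y < 2 ^ w
      | Div | Mod | Shr => x < 2 ^ w
      | Defs.Lt => 1 < 2 ^ w
      | _ => True
      end]
  end.

Lemma eval_den s e : safe s e -> Defs.eval w s e = den s e.
Proof.
elim: e => [k|x|t i IH|o e1 IH1 e2 IH2] /=.
- exact: modn_small.
- by [].
- by move=> /IH ->.
- case=> /IH1 -> /IH2 -> {IH1 IH2}; case: o => //=; rewrite /binop_sem.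
  all: set x := den s e1; set y := den s e2.
  + exact: modn_small.
  + move=> /andP[yx xw].
    rewrite addnBA ?(leq_trans yx (ltnW xw))// addnC -addnBA// modnDl modn_small//; lia.
  + exact: modn_small.
  + by move=> xw; rewrite modn_small//; apply: leq_ltn_trans xw; exact: leq_div.
  + by move=> xw; rewrite modn_small//; apply: leq_ltn_trans xw; exact: leq_mod.
  + by move=> xw; rewrite modn_small//; apply: leq_ltn_trans xw; exact: leq_div.
  + by move=> w1; rewrite modn_small//; case: (x < y) => //; exact: ltnW.
Qed.

Lemma runs_assign x e s (Q : state -> Prop) :
  safe s e -> Q (set_reg s x (den s e)) -> runs (Assign x e) s (cost e).+1 Q.
Proof.
move=> /eval_den E q; exists (set_reg s x (den s e)), (cost e).+1; split => //.
rewrite -E; exact: ExecAssign.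
Qed.

Lemma runs_store t i e s (Q : state -> Prop) :
  safe s i -> safe s e -> Q (set_tab s t (den s i) (den s e)) ->
  runs (Store t i e) s (cost i + cost e).+1 Q.
Proof.
move=> /eval_den Ei /eval_den E q.
exists (set_tab s t (den s i) (den s e)), (cost i + cost e).+1; split => //.
rewrite -E -Ei; exact: ExecStore.
Qed.

Lemma runs_assign_seq x e v c s k Q :
  safe s e -> den s e = v -> runs c (set_reg s x v) k Q ->
  runs (Seq (Assign x e) c) s ((cost e).+1 + k) Q.
Proof. by move=> se <- H; apply: runs_seq; apply: runs_assign. Qed.

Lemma runs_store_seq t i e u v c s k Q :
  safe s i -> safe s e -> den s i = u -> den s e = v ->
  runs c (set_tab s t u v) k Q ->
  runs (Seq (Store t i e) c) s ((cost i + cost e).+1 + k) Q.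
Proof. by move=> si se <- <- H; apply: runs_seq; apply: runs_store. Qed.

Lemma eval_lt s e1 e2 : safe s (Bin Defs.Lt e1 e2) ->
  Defs.eval w s (Bin Defs.Lt e1 e2) = (den s e1 < den s e2).
Proof. by move=> /eval_den. Qed.

End ProgramLogic.

(** * The encoder and the decoder *)

Section Program.
Local Open Scope nat_scope.

(* Registers: 0 [n], 1 [sigma], 2 [w], 3 block length, 4 its logarithm, 5 position in the
   string, 6 position in the encoding, 7 character, 8 [cumul], 9 [weight], 10 cell size,
   11 codeword length.  Tables: 2 counts, 3 codeword values, 4 codeword lengths,
   5 decoding table; 2, 3 and 4 are indexed by characters counted from 1. *)
Definition init_prog : cmd :=
  Seq (Assign 3 (Lit 1))
  (While (Bin Defs.Lt (Bin Mul (Reg 3) (Reg 3))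
                 (Bin Add (Reg 0) (Bin Mul (Lit 16) (Bin Mul (Reg 1) (Reg 1)))))
    (Seq (Assign 3 (Bin Add (Reg 3) (Reg 3)))
         (Assign 4 (Bin Add (Reg 4) (Lit 1))))).

(** The [+ 1] turns the strict [Lt] into the test [4 P <= g]; for a weight [g >= 2] the cell size
    [P], started at 1, ends with [2 P <= g < 4 P]. *)
Definition cell_prog : cmd :=
  While (Bin Defs.Lt (Bin Mul (Lit 4) (Reg 10)) (Bin Add (Reg 9) (Lit 1)))
    (Seq (Assign 10 (Bin Add (Reg 10) (Reg 10)))
         (Assign 11 (Bin Defs.Sub (Reg 11) (Lit 1)))).

Definition fill_prog : cmd :=
  While (Bin Defs.Lt (Reg 8) (Reg 12))
    (Seq (Store 5 (Reg 8) (Reg 7)) (Assign 8 (Bin Add (Reg 8) (Lit 1)))).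

Definition char_prog : cmd :=
  Seq (Assign 9 (Bin Add (Lit 2)
        (Bin Div (Bin Mul (Bin Defs.Sub (Reg 3) (Bin Mul (Lit 2) (Reg 1)))
                          (Look 2 (Bin Add (Reg 7) (Lit 1))))
                 (Reg 5))))
  (Seq (Assign 10 (Lit 1))
  (Seq (Assign 11 (Reg 4))
  (Seq cell_prog
  (Seq (Assign 7 (Bin Add (Reg 7) (Lit 1)))
  (Seq (Store 3 (Reg 7) (Bin Div (Bin Add (Reg 8) (Bin Defs.Sub (Reg 10) (Lit 1))) (Reg 10)))
  (Seq (Store 4 (Reg 7) (Reg 11))
  (Seq (Assign 12 (Bin Add (Reg 8) (Reg 9)))
  fill_prog))))))).

Definition rebuild_prog : cmd :=
  Seq (Assign 7 (Lit 0))
  (Seq (Assign 8 (Lit 0))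
  (While (Bin Defs.Lt (Reg 7) (Reg 1)) char_prog)).

(** Encoder and decoder share this loop: either step leaves the current character in register 7, so
    both update the same counts and build the same tables. A nonzero remainder, strictly inside a
    block, skips the rebuild. *)
Definition main_prog (step : cmd) : cmd :=
  Seq (While (Bin Defs.Lt (Reg 5) (Reg 0))
        (Seq (Ite (Bin Mod (Reg 5) (Reg 3)) Skip rebuild_prog)
        (Seq step
        (Seq (Store 2 (Reg 7) (Bin Add (Look 2 (Reg 7)) (Lit 1)))
             (Assign 5 (Bin Add (Reg 5) (Lit 1)))))))
      (Assign 0 (Reg 6)).

Definition coding_prog (step : cmd) : cmd := Seq init_prog (main_prog step).

(** The two stores are the two changed words of [packed_cat]. *)
Definition enc_step : cmd :=
  Seq (Assign 7 (Look 0 (Reg 5)))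
  (Seq (Assign 13 (Bin Div (Reg 6) (Reg 2)))
  (Seq (Assign 14 (Bin Mod (Reg 6) (Reg 2)))
  (Seq (Store 1 (Reg 13) (Bin Add (Look 1 (Reg 13))
         (Bin Shr (Bin Shl (Look 3 (Reg 7)) (Bin Defs.Sub (Reg 2) (Look 4 (Reg 7)))) (Reg 14))))
  (Seq (Store 1 (Bin Add (Reg 13) (Lit 1))
         (Bin Add (Look 1 (Bin Add (Reg 13) (Lit 1)))
           (Bin Shl (Look 3 (Reg 7))
             (Bin Add (Bin Defs.Sub (Reg 2) (Reg 14)) (Bin Defs.Sub (Reg 2) (Look 4 (Reg 7)))))))
  (Assign 6 (Bin Add (Reg 6) (Look 4 (Reg 7)))))))).

(** Register 15 receives the next [L] bits by the formula of [window_read]. *)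
Definition dec_step : cmd :=
  Seq (Assign 13 (Bin Div (Reg 6) (Reg 2)))
  (Seq (Assign 14 (Bin Mod (Reg 6) (Reg 2)))
  (Seq (Assign 15 (Bin Add
         (Bin Shr (Bin Shl (Look 0 (Reg 13)) (Reg 14)) (Bin Defs.Sub (Reg 2) (Reg 4)))
         (Bin Shr (Look 0 (Bin Add (Reg 13) (Lit 1)))
           (Bin Add (Bin Defs.Sub (Reg 2) (Reg 14)) (Bin Defs.Sub (Reg 2) (Reg 4))))))
  (Seq (Assign 7 (Look 5 (Reg 15)))
  (Seq (Store 1 (Reg 5) (Reg 7))
  (Assign 6 (Bin Add (Reg 6) (Look 4 (Reg 7)))))))).

(** * Correctness and running time on sufficiently large words *)

Section Correctness.
Variables (n sigma w : nat).
Let M := blocklen n sigma.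
Let L := loglen n sigma.
(** The square dominates the products that occur, such as [M * M], [n * M] and [16 sigma^2];
    [w_double] makes room for shift amounts that are sums of two numbers up to [w]. *)
Hypothesis word_large : 16 * ((M + n + sigma + 16) * (M + n + sigma + 16)) < 2 ^ w.
Hypothesis w_double : w + w < 2 ^ w.

Let M0 : 0 < M. Proof. exact: blocklen_gt0. Qed.

Let bound_lin : 16 * (M + n + sigma + 16) < 2 ^ w.
Proof. by nia. Qed.
Let bound_MM : 16 * (M * M) < 2 ^ w. Proof. by nia. Qed.
Let bound_nM : 16 * (n * M) < 2 ^ w. Proof. by nia. Qed.
Let bound_sq : n + 16 * (sigma * sigma) < 2 ^ w. Proof. by nia. Qed.
Let Lw : L <= w.
Proof.
rewrite -(@leq_exp2l 2)//; apply: ltnW; apply: leq_ltn_trans bound_lin.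
by rewrite -[2 ^ L]/M; lia.
Qed.
Let w0 : 0 < w. Proof. by case: (w) bound_lin => //; rewrite expn0; lia. Qed.

Definition params (s : state) : Prop :=
  [/\ reg s 0 = n, reg s 1 = sigma, reg s 2 = w, reg s 3 = M & reg s 4 = L].

(** The loop makes exactly [L] rounds: [loglen_min] keeps its test true before that, and
    [blocklen_sq] makes it false then. *)
Lemma run_init s0 : reg s0 0 = n -> reg s0 1 = sigma -> reg s0 2 = w -> reg s0 4 = 0 ->
  runs w init_prog s0 (22 * L + 14)
    (fun s => [/\ params s, forall x, 4 < x -> reg s x = reg s0 x & tab s = tab s0]).
Proof.
move=> r0 r1 r2 r4.
pose I l s := [/\ [/\ reg s 0 = n, reg s 1 = sigma, reg s 2 = w, reg s 3 = 2 ^ l & reg s 4 = l],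
  forall x, 4 < x -> reg s x = reg s0 x & tab s = tab s0].
apply: runs_conseq (_ : runs _ _ _ _ (I L)) _ _; last by [].
  apply: runs_assign_seq => //=; first by lia.
  apply: (@runs_while w I L (fun=> 10)) => [l s lL [[e0 e1 e2 e3 e4] er et]|s [[e0 e1 e2 e3 e4] er et]|].
  - have := loglen_min lL => lt.
    have lM : 2 ^ l <= M by rewrite leq_exp2l// ltnW.
    have lMM : 2 ^ l * 2 ^ l <= M * M by exact: leq_mul.
    have lle : l < M by apply: leq_trans lL _; exact: loglen_le.
    split.
      rewrite eval_lt /= ?e0 ?e1 ?e3; first by rewrite lt.
      by repeat split => //; lia.
    apply: runs_leq.
      apply: runs_assign_seq => /=.
      + by rewrite e3; split => //; lia.
      + reflexivity.
      + apply: runs_assign => /=; first by rewrite e4; repeat split => //; lia.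
        rewrite /I /= e3 e4; split; last by [].
          by split => //; rewrite ?expnS; lia.
        by case=> [|[|[|[|[|x]]]]] //= x5; apply: er.
    by [].
  - rewrite eval_lt /= ?e0 ?e1 ?e3.
      have := blocklen_sq n sigma; rewrite /blocklen -/L.
      by move: (2 ^ L) => m H; rewrite ltnNge H.
    rewrite -[2 ^ L]/M; repeat split => //; lia.
  - rewrite /I /=; split => //.
    by case=> [|[|[|[|[|x]]]]].
rewrite sum_nat_const card_ord /=; lia.
Qed.

Lemma run_cell s0 g e : reg s0 9 = g -> 2 * 2 ^ e <= g < 4 * 2 ^ e -> g <= M ->
  e <= L -> reg s0 10 = 1 -> reg s0 11 = L ->
  runs w cell_prog s0 (16 * e + 8)
    (fun s => [/\ reg s 10 = 2 ^ e, reg s 11 = L - e,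
       forall x : nat, x != 10 -> x != 11 -> reg s x = reg s0 x & tab s = tab s0]).
Proof.
move=> r9 /andP[glo ghi] gM eL r10 r11.
pose I i s := [/\ reg s 10 = 2 ^ i, reg s 11 = L - i,
       forall x : nat, x != 10 -> x != 11 -> reg s x = reg s0 x & tab s = tab s0].
have pe i : i <= e -> 4 * 2 ^ i <= 2 * M.
  move=> ie; have : 2 ^ i <= 2 ^ e by rewrite leq_exp2l//.
  lia.
have LM := loglen_le n sigma; rewrite -/L -/M in LM.
apply: runs_leq.
  apply: (@runs_while w I e (fun=> 8)) => [i s ie [e10 e11 er et]|s [e10 e11 er et]|].
  - have pi := pe _ (ltnW ie).
    have pi' : 2 ^ i.+1 <= 2 ^ e by rewrite leq_exp2l//.
    rewrite expnS in pi'; split.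
      rewrite eval_lt /= ?e10 ?er ?r9 //; last by repeat split => //; lia.
      by have -> : 4 * 2 ^ i < g + 1 by lia.
    apply: runs_leq.
      apply: runs_assign_seq => /=.
      + by rewrite e10; split => //; lia.
      + reflexivity.
      + apply: runs_assign => /=; first by rewrite e11; repeat split => //; lia.
        rewrite /I /= e10 e11; split; [by rewrite expnS; lia|by lia| |by []].
        move=> x x10 x11; rewrite (negPf x10) (negPf x11); exact: er.
    by [].
  - have pi := pe _ (leqnn e).
    rewrite eval_lt /= ?e10 ?er ?r9 //; last by repeat split => //; lia.
    by have -> : 4 * 2 ^ e < g + 1 = false by lia.
  - by rewrite /I r10 r11 subn0.
by rewrite sum_nat_const card_ord /=; lia.
Qed.

Lemma run_fill s0 a C g : reg s0 7 = a -> reg s0 8 = C -> reg s0 12 = C + g -> C + g <= M ->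
  runs w fill_prog s0 (11 * g + 4)
    (fun s => [/\ reg s 8 = C + g, forall x : nat, x != 8 -> reg s x = reg s0 x &
       forall t x, tab s t x = if (t == 5) && (C <= x < C + g) then a else tab s0 t x]).
Proof.
move=> r7 r8 r12 CM.
pose I i s := [/\ reg s 8 = C + i, forall x : nat, x != 8 -> reg s x = reg s0 x &
  forall t x, tab s t x = if (t == 5) && (C <= x < C + i) then a else tab s0 t x].
apply: runs_leq.
  apply: (@runs_while w I g (fun=> 7)) => [i s ig [e8 er et]|s [e8 er et]|].
  - split.
      rewrite eval_lt /= ?e8 ?er ?r12 //; last by repeat split => //; lia.
      by rewrite ltn_add2l ig.
    apply: runs_leq.
      apply: runs_store_seq => //=.
      apply: runs_assign => /=; first by rewrite e8; repeat split => //; lia.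
      rewrite /I /= e8; split; first by lia.
        by move=> x /negPf x8; rewrite x8; apply: er; rewrite x8.
      move=> t x; rewrite et er// r7; case: (t == 5) => //=.
      by case: eqVneq => [->|]; do 2?case: ifP; lia.
    by [].
  - rewrite eval_lt /= ?e8 ?er ?r12 //; last by repeat split => //; lia.
    by rewrite ltnn.
  - rewrite /I addn0 r8; split => // t x.
    have -> : C <= x < C = false by lia.
    by rewrite andbF.
by rewrite sum_nat_const card_ord /=; lia.
Qed.

Definition tables_for (q : seq nat) (k : nat) (s : state) : Prop :=
  forall i, i < k ->
  [/\ tab s 3 i.+1 = codeval n sigma q i, tab s 4 i.+1 = codelen n sigma q i &
      forall x, cumul n sigma q i <= x < cumul n sigma q i.+1 -> tab s 5 x = i.+1].

(** Frame condition of a rebuild: the registers and tables listed hold parameters, positions, input,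
    output and counts; the others are scratch or are being rebuilt. *)
Definition agree (s0 s : state) : Prop :=
  (forall x, x < 7 -> reg s x = reg s0 x) /\
  (forall t i, t < 3 -> tab s t i = tab s0 t i).

Lemma run_char q i s0 : all (gtn sigma) q -> size q <= n -> i < sigma ->
  params s0 -> reg s0 5 = size q -> reg s0 7 = i -> reg s0 8 = cumul n sigma q i ->
  tab s0 2 i.+1 = count_mem i q -> tables_for q i s0 ->
  runs w char_prog s0 (27 * weight n sigma q i + 80)
    (fun s => [/\ agree s0 s, reg s 7 = i.+1, reg s 8 = cumul n sigma q i.+1 &
       tables_for q i.+1 s]).
Proof.
move=> qs qn si [r0 r1 r2 r3 r4] r5 r7 r8 t2 tf.
have wl := weight_le n qs si; rewrite -/M in wl.
have cl := cumul_le_block n qs si; rewrite -/M in cl.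
have eL := cellexp_lt n qs si; rewrite -/L in eL.
have ep := cellexpP n qs i.
have cS := cumulS n sigma q i.
have M4 := blocklen_alphabet n sigma; rewrite -/M in M4.
have DcM : (M - 2 * sigma) * count_mem i q <= n * M.
  rewrite mulnC leq_mul// ?leq_subr//; apply: leq_trans qn; exact: count_size.
have wE : weight n sigma q i = 2 + (M - 2 * sigma) * count_mem i q %/ size q by [].
have e1 : 0 < 2 ^ cellexp n sigma q i by rewrite expn_gt0.
apply: runs_leq.
  apply: runs_assign_seq => /=.
  - by rewrite r1 r3 r5 r7 addn1 t2 -wE; repeat split => //; lia.
  - by rewrite r1 r3 r5 r7 addn1 t2 -wE.
  apply: runs_assign_seq => /=; [lia|reflexivity|].
  apply: runs_assign_seq => //=.
  apply: runs_seq; apply: runs_conseq; first apply: run_cell ep wl (ltnW eL) _ _ => //=.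
    exact: leqnn.
  move=> s1 [e10 e11 er et] /=.
  have {}er x : x < 10 -> reg s1 x = if x == 9 then weight n sigma q i else reg s0 x.
    by move=> x10; rewrite er /=; case: x x10 => [|[|[|[|[|[|[|[|[|[|[|[|x]]]]]]]]]]]].
  rewrite /= in et.
  apply: (runs_assign_seq (v := i.+1)) => /=.
  - by rewrite er//= r7; split => //; lia.
  - by rewrite er//= r7 addn1.
  apply: (runs_store_seq (u := i.+1) (v := codeval n sigma q i)) => /=.
  - by [].
  - by rewrite e10 er//= r8; repeat split => //; lia.
  - by [].
  - by rewrite e10 er//= r8 subn1 -/(codeval n sigma q i).
  apply: (runs_store_seq (u := i.+1) (v := codelen n sigma q i)) => //=.
  apply: (runs_assign_seq (v := cumul n sigma q i + weight n sigma q i)) => /=.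
  - by rewrite !er//= r8; repeat split => //; lia.
  - by rewrite !er//= r8.
  apply: runs_conseq; first apply: (@run_fill _ i.+1 (cumul n sigma q i) (weight n sigma q i)) => /=.
  - by [].
  - by rewrite er//= r8.
  - by [].
  - by rewrite -cS.
  - exact: leqnn.
  move=> s2 [e8 er2 et2]; split.
  - split => [x x7|t k t3].
      by rewrite er2; case: x x7 => [|[|[|[|[|[|[|x]]]]]]] //= _; rewrite er.
    by rewrite et2; case: t t3 => [|[|[|t]]] //=; rewrite et.
  - by rewrite er2.
  - by rewrite e8 cS.
  - move=> k; rewrite ltnS leq_eqVlt => /orP[/eqP ->|ki].
      rewrite !et2 /= !eqxx; split => // x xc.
      by rewrite et2 /= -cS xc.
    (* Earlier characters keep their entries, because their cells end no later than the new cell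
       starts. *)
    have [t3 t4 t5] := tf k ki.
    have ik : (k.+1 == i.+1) = false by lia.
    rewrite !et2 /= ik !et; split => // x xc.
    rewrite et2 /= et t5//; case: ifP => //.
    by have := cumul_mono n qs ki; lia.
(* From [e < 2 ^ e] and [2 * 2 ^ e <= weight], the cost of [cell_prog] is absorbed into a multiple
   of the weight. *)
rewrite /=; have : cellexp n sigma q i < 2 ^ cellexp n sigma q i by exact: ltn_expl.
by lia.
Qed.

(** The cost per character is linear in its weight, and the weights sum to at most [M]; hence time
    [O(M + sigma)]. *)
Lemma run_rebuild q s0 : all (gtn sigma) q -> size q <= n ->
  params s0 -> reg s0 5 = size q ->
  (forall i, i < sigma -> tab s0 2 i.+1 = count_mem i q) ->
  runs w rebuild_prog s0 (27 * M + 84 * sigma + 8)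
    (fun s => agree s0 s /\ tables_for q sigma s).
Proof.
move=> qs qn [r0 r1 r2 r3 r4] r5 t2.
pose I i s := [/\ agree s0 s, reg s 7 = i, reg s 8 = cumul n sigma q i & tables_for q i s].
apply: runs_conseq (_ : runs _ _ _ _ (I sigma)) _ _; last by move=> s [].
  apply: runs_assign_seq => /=; [lia|reflexivity|].
  apply: runs_assign_seq => /=; [lia|reflexivity|].
  apply: (@runs_while w I sigma (fun i => 27 * weight n sigma q i + 80)).
  - move=> i s si [[er et] e7 e8 tf]; split.
      rewrite eval_lt /= ?e7 ?er ?r1 //; last by repeat split => //; lia.
      by rewrite si.
    apply: runs_conseq; first apply: (run_char qs qn si) => //.
    + by rewrite /params !er.
    + by rewrite er.
    + by rewrite et// t2.
    + exact: leqnn.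
    + move=> s' [[er' et'] e7' e8' tf']; split => //; split=> [x x7|t k t3].
        by rewrite er'// er.
      by rewrite et'// et.
  - move=> s [[er et] e7 e8 tf].
    rewrite eval_lt /= ?e7 ?er ?r1 //; last by repeat split => //; lia.
    by rewrite ltnn.
  - split => //=; last by rewrite /cumul big_ord0.
    by split => //; case=> [|[|[|[|[|[|[|x]]]]]]].
rewrite /= big_split /= sum_nat_const card_ord big_split /= sum_nat_const card_ord.
rewrite -big_distrr /=.
by have := cumul_le n qs; rewrite /cumul -/M; move: (\sum_(k < sigma) _) => x; lia.
Qed.

Definition time_bound : nat := 240 * (n + M).

Section MainLoop.
Variables (s : seq nat) (step : cmd) (J : nat -> state -> Prop) (start : state).
Hypotheses (size_s : size s = n) (s_lt : all (gtn sigma) s).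
(** The invariant of a step may depend only on the position in the encoding and on the input and
    output tables, so rebuilding and counting preserve it. *)
Hypothesis J_ext : forall j st st', J j st -> reg st' 6 = reg st 6 ->
  (forall t i, t < 2 -> tab st' t i = tab st t i) -> J j st'.
Hypothesis step_ok : forall j st, j < n -> params st -> reg st 5 = j ->
  tables_for (take (stale n sigma j) s) sigma st -> J j st ->
  runs w step st 60 (fun st' => [/\ reg st' 7 = (nth 0 s j).+1,
    forall x, x < 6 -> reg st' x = reg st x,
    forall t i, 1 < t -> tab st' t i = tab st t i & J j.+1 st']).

(** Amortization: charging [M] at each block start among the first [m] positions costs at most
    [m + M], the extra [M] being for an incomplete last block. *)
Lemma sum_dvdn_le m : (\sum_(j < m) (M %| j)) * M <= m + M.
Proof.
case: m => [|m]; first by rewrite big_ord0.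
suff -> : \sum_(j < m.+1) (M %| j) = (m %/ M).+1.
  by rewrite mulSn; have := leq_divM m M; lia.
elim: m => [|m IH]; first by rewrite big_ord1 dvdn0 div0n.
by rewrite big_ord_recr /= IH divnS//; lia.
Qed.

Lemma run_main st0 : params st0 -> reg st0 5 = 0 -> (forall t i, 1 < t -> tab st0 t i = 0) ->
  J 0 st0 ->
  runs w (main_prog step) st0 (200 * (n + M))
   (fun st => exists2 st', J n st' & st = set_reg st' 0 (reg st' 6)).
Proof.
move=> par0 r5 t0 J0.
(* At a block start the tables still belong to the preceding block, or are empty, so nothing is
   asked of them before the rebuild. *)
pose I j st := [/\ params st, reg st 5 = j,
  forall i, i < sigma -> tab st 2 i.+1 = count_mem i (take j s),
  ~~ (M %| j) -> tables_for (take (stale n sigma j) s) sigma st & J j st].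
pose k j := (if M %| j then 27 * M + 84 * sigma + 8 else 1) + 80.
have M4 := blocklen_alphabet n sigma; rewrite -/M in M4.
rewrite /main_prog; apply: runs_leq.
- apply: runs_seq; apply: runs_conseq.
  + apply: (@runs_while w I n k).
    * move=> j st jn [[r0 r1 r2 r3 r4] e5 cnt tf Jj]; split.
        rewrite eval_lt /= ?e5 ?r0 //; last by repeat split => //; lia.
        by rewrite jn.
      have jS : size (take j s) = j by rewrite size_take size_s jn.
      have evalM : Defs.eval w st (Bin Mod (Reg 5) (Reg 3)) = j %% M.
        by rewrite eval_den /= ?e5 ?r3 //; repeat split => //; lia.
      pose Q st1 := [/\ params st1, reg st1 5 = j,
        forall i, i < sigma -> tab st1 2 i.+1 = count_mem i (take j s),
        tables_for (take (stale n sigma j) s) sigma st1 & J j st1].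
      apply: runs_leq; first apply: (@runs_seq _ _ _ _ _ 70 (I j.+1)).
      apply: (@runs_conseq _ _ _ _ _ Q); first
        apply: (@runs_ite _ _ _ _ _ (if M %| j then 27 * M + 84 * sigma + 8 else 1)).
      -- rewrite evalM => H; rewrite /dvdn (negPf H).
         by apply: runs_skip; split => //; exact: tf.
      -- rewrite evalM => H; have Mj : M %| j by rewrite /dvdn H.
         have stE : stale n sigma j = j by rewrite /stale divnK.
         rewrite Mj; apply: runs_conseq; first apply: (@run_rebuild (take j s)).
         ++ by apply/allP => x /mem_take; exact: (allP s_lt).
         ++ by rewrite jS ltnW.
         ++ by [].
         ++ by rewrite jS.
         ++ exact: cnt.
         ++ exact: leqnn.
         ++ move=> st1 [[er et] tf1]; split.
            ** by rewrite /params !er.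
            ** by rewrite er.
            ** by move=> i si; rewrite et// cnt.
            ** by rewrite stE.
            ** by apply: J_ext Jj _ _ => [|t i t2]; [rewrite er|rewrite et// ltnW].
      -- exact: leqnn.
      -- move=> st1 [par1 e51 cnt1 tf1 J1].
         have sj : nth 0 s j < sigma by apply: (allP s_lt); rewrite mem_nth// size_s.
         apply: runs_leq.
           apply: runs_seq; apply: (runs_conseq (step_ok jn par1 e51 tf1 J1)); first exact: leqnn.
           move=> st2 [e7 er et J2].
           have [r01 r11 r21 r31 r41] := par1.
           apply: runs_store_seq => /=.
           ** by [].
           ** rewrite e7 et// cnt1//; repeat split => //; first by lia.
              by have := count_size (pred1 (nth 0 s j)) (take j s); rewrite jS; lia.
           ** by [].
           ** by [].
           ** apply: runs_assign => /=; first by rewrite er// e51; repeat split => //; lia.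
              rewrite (er 5)// e51; split => //=.
              +++ by rewrite /params /= !er.
              +++ by rewrite addn1.
              +++ move=> i si; rewrite e7 !et// !cnt1// (take_nth 0) ?size_s// -cats1 count_cat /= addn0.
                  rewrite eqSS [nth 0 s j == i]eq_sym.
                  by case: eqVneq => [->|]; rewrite ?addn0.
              (* If [j.+1] starts no block, it lies in the block of [j] and the tables stay
                 valid. *)
              +++ move=> nd i si.
                  have stS : stale n sigma j.+1 = stale n sigma j.
                    by rewrite /stale divnS// (negPf nd).
                  rewrite stS; have [h3 h4 h5] := tf1 i si.
                  by split => [||x xc] /=; rewrite et// ?h3 ?h4 ?h5.
              +++ by apply: J_ext J2 _ _ => //= t i; case: t => [|[|t]].
         by rewrite /=.
      -- by rewrite /k; case: ifP => _ /=; lia.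
    * move=> st [[r0 r1 r2 r3 r4] e5 _ _ _].
      rewrite eval_lt /= ?e5 ?r0 //; last by repeat split => //; lia.
      by rewrite ltnn.
    * split => //; first by move=> i si; rewrite t0// take0.
      by rewrite dvdn0.
  + exact: leqnn.
  + move=> st [_ _ _ _ Jn]; apply: runs_assign => //.
    by exists st.
- rewrite /= big_split /= sum_nat_const card_ord /k big_split /= sum_nat_const card_ord.
  have : \sum_(i < n) (if M %| i then 27 * M + 84 * sigma + 8 else 1) <= 60 * (n + M) + n.
    (* By [4 * sigma <= M], a rebuild costs at most [60 * M + 1]. *)
    apply: (@leq_trans (\sum_(i < n) (60 * ((M %| i) * M) + 1))).
      by apply: leq_sum => i _; case: (M %| i) => //=; lia.
    rewrite big_split /= -big_distrr -big_distrl /= sum_nat_const card_ord muln1.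
    by have := sum_dvdn_le n; rewrite leq_add2r leq_mul2l.
  by move: (\sum_(i < n) _) => x; lia.
Qed.

Lemma run_coding : (forall x, reg start x = nth 0 [:: n; sigma; w] x) ->
  (forall t i, 0 < t -> tab start t i = 0) -> J 0 start ->
  runs w (coding_prog step) start time_bound
    (fun st => exists2 st', J n st' & st = set_reg st' 0 (reg st' 6)).
Proof.
move=> r0 t0 J0; apply: runs_leq.
  apply: runs_seq; apply: runs_conseq; first apply: run_init; rewrite ?r0//.
  move=> st [par er et]; apply: run_main => //.
  - by rewrite er// r0.
  - by move=> t i t1; rewrite et t0// ltnW.
  - by apply: J_ext J0 _ _ => [|t i _]; rewrite ?er ?et.
by have := loglen_le n sigma; rewrite /time_bound -/M -/L; lia.
Qed.

End MainLoop.

(** * Encoding and decoding one character *)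

Section Steps.
Variable s : seq nat.
Hypotheses (size_s : size s = n) (s_lt : all (gtn sigma) s).

(** The output table is specified at every index: words beyond the end are zero, so a codeword can
    be appended by addition. *)
Definition enc_inv (j : nat) (st : state) : Prop :=
  [/\ reg st 6 = size (encode_upto n sigma s j),
      forall i, i < n -> tab st 0 i = (nth 0 s i).+1 &
      forall i, tab st 1 i = packed w (encode_upto n sigma s j) i].

Definition dec_inv (j : nat) (st : state) : Prop :=
  [/\ reg st 6 = size (encode_upto n sigma s j),
      forall i, tab st 0 i = packed w (encode_upto n sigma s n) i &
      forall i, i < j -> tab st 1 i = (nth 0 s i).+1].

Let stale_lt j : all (gtn sigma) (take (stale n sigma j) s).
Proof. by apply/allP => x /mem_take; exact: (allP s_lt). Qed.

Let pos_lt j : j <= n -> 16 * size (encode_upto n sigma s j) < 2 ^ w.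
Proof.
move=> jn; apply: leq_ltn_trans bound_nM; rewrite leq_mul2l /=.
apply: leq_trans (size_encode_upto _ _ _ _) _; apply: leq_mul => //.
exact: loglen_le.
Qed.

Lemma run_enc_step j st : j < n -> params st -> reg st 5 = j ->
  tables_for (take (stale n sigma j) s) sigma st -> enc_inv j st ->
  runs w enc_step st 60 (fun st' => [/\ reg st' 7 = (nth 0 s j).+1,
    forall x, x < 6 -> reg st' x = reg st x,
    forall t i, 1 < t -> tab st' t i = tab st t i & enc_inv j.+1 st']).
Proof.
move=> jn [r0 r1 r2 r3 r4] r5 tf [r6 t0 t1].
have aS : nth 0 s j < sigma by apply: (allP s_lt); rewrite mem_nth// size_s.
have [t3 t4 _] := tf _ aS.
have lenL := codelen_le n sigma (take (stale n sigma j) s) (nth 0 s j).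
have cv := codeval_lt n (stale_lt j) aS.
have bP := pos_lt jn; have bP0 := pos_lt (ltnW jn).
have pk := @packed_cat w (encode_upto n sigma s j)
  (codeword n sigma (take (stale n sigma j) s) (nth 0 s j)).
have ES := encode_uptoS n sigma s j.
have wn := window_bits cv.
rewrite -ES size_bits wn in pk.
move: pk => /(_ _ (leq_trans lenL Lw) w0) /= pk.
have sS : size (encode_upto n sigma s j.+1) = size (encode_upto n sigma s j) +
   codelen n sigma (take (stale n sigma j) s) (nth 0 s j) by rewrite ES size_cat size_bits.
rewrite sS in bP.
set pos := size (encode_upto n sigma s j) in pk bP bP0 sS r6.
set len := codelen _ _ _ _ in t4 lenL cv pk bP sS.
set cd := codeval _ _ _ _ in t3 cv pk.
set b1 := encode_upto n sigma s j.+1 in pk sS ES.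
set b0 := encode_upto n sigma s j in pk t1 ES.
have lw : len <= w := leq_trans lenL Lw.
have shl : (cd * 2 ^ (w - len)) %% 2 ^ w = cd * 2 ^ (w - len).
  by rewrite modn_small// -[X in _ < 2 ^ X](subnKC lw) expnD ltn_pmul2r// expn_gt0.
have rw : pos %% w < w by exact: ltn_pmod.
have qle : pos %/ w <= pos by exact: leq_div.
have pk0 : packed w b0 (pos %/ w) + (cd * 2 ^ (w - len)) %/ 2 ^ (pos %% w) = packed w b1 (pos %/ w).
  by rewrite pk eqxx.
have pk1 : packed w b0 (pos %/ w).+1 + (cd * 2 ^ (w - pos %% w + (w - len))) %% 2 ^ w =
    packed w b1 (pos %/ w).+1.
  by rewrite pk eqxx; case: eqP => // E; exfalso; lia.
have pl i : packed w b1 i < 2 ^ w by rewrite packedE window_lt.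
have qq : (pos %/ w).+1 == pos %/ w = false by lia.
have [h1 h2 h3 h4] : [/\ pos < 2 ^ w, (pos %/ w).+1 < 2 ^ w, pos %% w <= w < 2 ^ w &
    len <= w < 2 ^ w].
  by move: bP0 w_double rw qle lw; clear; split; lia.
have [h5 h6] : w - pos %% w + (w - len) < 2 ^ w /\ pos + len < 2 ^ w.
  by move: bP w_double; clear; split; lia.
apply: runs_leq.
  apply: (runs_assign_seq (v := (nth 0 s j).+1)) => /=; [by []|by rewrite r5 t0|].
  apply: (runs_assign_seq (v := pos %/ w)) => /=; [by rewrite r6|by rewrite r6 r2|].
  apply: (runs_assign_seq (v := pos %% w)) => /=; [by rewrite r6|by rewrite r6 r2|].
  apply: (runs_store_seq (u := pos %/ w) (v := packed w b1 (pos %/ w))) => /=.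
  - by [].
  - rewrite r2 t1 t3 t4 shl pk0; repeat split => //.
    by rewrite -shl ltn_pmod ?expn_gt0.
  - by [].
  - by rewrite r2 t1 t3 t4 shl pk0.
  apply: (runs_store_seq (u := (pos %/ w).+1) (v := packed w b1 (pos %/ w).+1)) => /=.
  - by rewrite addn1; repeat split => //; exact: leq_ltn_trans h2.
  - by rewrite r2 addn1 qq t1 t3 t4 pk1; repeat split => //; exact: leq_ltn_trans h2.
  - by rewrite addn1.
  - by rewrite r2 addn1 qq t1 t3 t4 pk1.
  apply: runs_assign => /=; first by rewrite r6 t4.
  rewrite r6 t4; split => //=.
  - by move=> x; case: x => [|[|[|[|[|[|x]]]]]].
  - by move=> t i; case: t => [|[|t]].
  - split => //= i; case: (eqVneq i (pos %/ w).+1) => [->//|n1].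
    case: (eqVneq i (pos %/ w)) => [->//|n2].
    by rewrite t1 pk (negPf n1) (negPf n2).
by [].
Qed.

Lemma run_dec_step j st : j < n -> params st -> reg st 5 = j ->
  tables_for (take (stale n sigma j) s) sigma st -> dec_inv j st ->
  runs w dec_step st 60 (fun st' => [/\ reg st' 7 = (nth 0 s j).+1,
    forall x, x < 6 -> reg st' x = reg st x,
    forall t i, 1 < t -> tab st' t i = tab st t i & dec_inv j.+1 st']).
Proof.
move=> jn [r0 r1 r2 r3 r4] r5 tf [r6 t0 t1].
have aS : nth 0 s j < sigma by apply: (allP s_lt); rewrite mem_nth// size_s.
have [_ t4 t5] := tf _ aS.
have cv := codeval_lt n (stale_lt j) aS.
have bP := pos_lt jn; have bP0 := pos_lt (ltnW jn).
have ES := encode_uptoS n sigma s j.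
have [b2 Eb] := encode_upto_prefix n sigma s jn.
have sS : size (encode_upto n sigma s j.+1) = size (encode_upto n sigma s j) +
   codelen n sigma (take (stale n sigma j) s) (nth 0 s j) by rewrite ES size_cat size_bits.
set f := nth false (encode_upto n sigma s n).
set pos := size (encode_upto n sigma s j) in bP0 sS r6.
(* The encoding up to [j.+1] is a prefix of the whole, so the codeword stands at [pos]; whatever
   follows it, even padding, [codeword_lookup] finds the right cell. *)
have fw : window f pos (codelen n sigma (take (stale n sigma j) s) (nth 0 s j)) =
    codeval n sigma (take (stale n sigma j) s) (nth 0 s j).
  rewrite -[RHS](window_bits cv); apply: eq_window => k kl.
  rewrite /f Eb ES -catA nth_cat ltnNge leq_addr /= addKn nth_cat size_bits kl.
  by rewrite add0n.
have lk := codeword_lookup (stale_lt j) aS fw.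
have rd := window_read f pos Lw w0.
have rw : pos %% w < w by exact: ltn_pmod.
have qle : pos %/ w <= pos by exact: leq_div.
have wl : window f pos L < 2 ^ w.
  by apply: leq_trans (window_lt f pos L) _; rewrite leq_exp2l.
have rm : window f (pos %/ w * w) w * 2 ^ (pos %% w) %% 2 ^ w < 2 ^ w by rewrite ltn_pmod ?expn_gt0.
have [h1 h2 h3 h4 h5] : [/\ pos < 2 ^ w, (pos %/ w).+1 < 2 ^ w, pos %% w <= w < 2 ^ w,
    L <= w < 2 ^ w & w - pos %% w + (w - L) < 2 ^ w].
  by move: bP0 w_double rw qle Lw; clear; split; lia.
have h6 : 1 < 2 ^ w by exact: leq_ltn_trans h2.
have h7 : size (encode_upto n sigma s j.+1) < 2 ^ w by move: bP; clear; lia.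
apply: runs_leq.
  apply: (runs_assign_seq (v := pos %/ w)) => /=; [by rewrite r6|by rewrite r6 r2|].
  apply: (runs_assign_seq (v := pos %% w)) => /=; [by rewrite r6|by rewrite r6 r2|].
  apply: (runs_assign_seq (v := window f pos L)) => /=.
  - rewrite r2 r4 addn1 !t0 !packedE -/f rd; repeat split => //.
    exact: window_lt.
  - by rewrite r2 r4 addn1 !t0 !packedE -/f rd.
  apply: (runs_assign_seq (v := (nth 0 s j).+1)) => /=; [by []|exact: t5|].
  apply: (runs_store_seq (u := j) (v := (nth 0 s j).+1)) => //=.
  apply: runs_assign => /=; first by rewrite r6 t4 -sS.
  rewrite r6 t4 -sS; split => //=.
  - by move=> x; case: x => [|[|[|[|[|[|x]]]]]].
  - by move=> t i; case: t => [|[|t]].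
  - split => //= i; rewrite ltnS leq_eqVlt => /orP[/eqP ->|ij]; first by rewrite eqxx.
    by rewrite t1//; case: eqP => [->|].
by [].
Qed.

End Steps.

Lemma encodes_block_coder (S : n.-tuple 'I_sigma) :
  encodes_within w (coding_prog enc_step) S (encoding block_coder S) time_bound.
Proof.
have size_s : size (map val S) = n by rewrite size_map size_tuple.
have s_lt : all (gtn sigma) (map val S).
  by apply/allP => x /mapP[a _ ->]; exact: ltn_ord.
have [|||||st [k [ex kT [st' [r6 _ t1] E]]]] :=
  @run_coding _ enc_step (enc_inv (map val S)) (init_state w n sigma (string_table S)) size_s s_lt.
- move=> j st st' [r6 t0 t1] er et.
  by split => [|i|i]; rewrite ?er ?et//; exact: t0.
- exact: run_enc_step.
- by [].
- by move=> [].
- split => // [i ni|i] /=; last by rewrite nth_packed0.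
  rewrite /string_table; have iS : i < size S by rewrite size_tuple.
  by case: (tval S) iS => // a S' iS; rewrite !(nth_map a).
exists st, k; rewrite encoding_block_coder; split => //; first by rewrite E.
by move=> i _; rewrite E /= t1.
Qed.

Lemma decodes_block_coder (S : n.-tuple 'I_sigma) :
  decodes_within w (coding_prog dec_step) (encoding block_coder S) S time_bound.
Proof.
have size_s : size (map val S) = n by rewrite size_map size_tuple.
have s_lt : all (gtn sigma) (map val S).
  by apply/allP => x /mapP[a _ ->]; exact: ltn_ord.
have [|||||st [k [ex kT [st' [_ _ t1] E]]]] :=
  @run_coding _ dec_step (dec_inv (map val S))
    (init_state w n sigma (packed w (encoding block_coder S))) size_s s_lt.
- move=> j st st' [r6 t0 t1] er et.
  by split => [|i|i ij]; rewrite ?er ?et// t1.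
- exact: run_dec_step.
- by [].
- by move=> [].
- by split => // i; rewrite encoding_block_coder.
exists st, k; split => // j jn; rewrite E /= t1// /string_table.
have jS : j < size S by rewrite size_tuple.
by case: (tval S) jS => // a S' jS; rewrite !(nth_map a).
Qed.

End Correctness.
End Program.

(** * Word sizes with room for all intermediate values *)

Section WordSize.
Local Open Scope nat_scope.

(** Let [y = 2 ^ bit_length (n + sigma)], so [y >= 2]. The bracketed sum is at most [32 * y], and
    [y ^ 9 >= 256 * y] exceeds four times that; squaring gives the exponent [18 = 9 + 9]. *)
Lemma word_size_bounds w n sigma : word_size_ok 18 w n sigma ->
  16 * ((blocklen n sigma + n + sigma + 16) * (blocklen n sigma + n + sigma + 16)) < 2 ^ w /\
  w + w < 2 ^ w.
Proof.
rewrite /word_size_ok /bit_length => H; split.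
  apply: leq_trans (_ : 2 ^ (18 * (trunc_log 2 (n + sigma)).+1) <= _); last by rewrite leq_exp2l.
  have := trunc_log_ltn (n + sigma) (isT : 1 < 2).
  have : 2 <= 2 ^ (trunc_log 2 (n + sigma)).+1 by rewrite expnS leq_pmulr// expn_gt0.
  rewrite [18 * _]mulnC expnM; move: (2 ^ _) => y y2 Hy.
  have Ml := blocklen_linear n sigma.
  have y8 : 2 ^ 8 <= y ^ 8 by rewrite leq_exp2r.
  rewrite -[18]/(9 + 9) expnD ![y ^ 9]expnS; move: (y ^ 8) y8 => z.
  rewrite -[2 ^ 8]/(2 * 128) => z8.
  have X1 : blocklen n sigma + n + sigma + 16 <= 32 * y by lia.
  have X2 : 128 * y < y * z by nia.
  by move: (blocklen n sigma + n + sigma + 16) X1 => u X1; nia.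
have w5 : 5 <= w by lia.
rewrite addnn -(subnK w5); elim: (w - 5) => [|d IH] //.
by rewrite addSn expnS; lia.
Qed.

End WordSize.

(** * Redundancy *)

Section Redundancy.
Variable R : realType.
Local Notation lnn k := (ln ((k)%:R : R)).

Lemma ln_nat_ge0 k : 0 <= lnn k.
Proof. by case: k => [|k]; [rewrite ln0|rewrite ln_ge0// ler1n]. Qed.

Lemma ler_ln_nat a b : (a <= b)%N -> lnn a <= lnn b.
Proof.
case: a => [_|a ab]; first by rewrite [lnn 0]ln0// ln_nat_ge0.
by rewrite ler_ln ?posrE ?ltr0n ?ler_nat//; exact: leq_trans ab.
Qed.

Lemma ln_natM a b : (0 < a)%N -> (0 < b)%N -> lnn (a * b)%N = lnn a + lnn b.
Proof. by move=> a0 b0; rewrite natrM lnM// posrE ltr0n. Qed.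

Lemma ln_nat_exp2 k : lnn (2 ^ k)%N = k%:R * ln 2.
Proof. by rewrite natrX lnXn// mulr_natl. Qed.

Lemma ln_tangent (x y : R) : 0 < x -> 0 < y -> y * (ln x - ln y) <= x - y.
Proof.
move=> x0 y0; rewrite -ln_div ?posrE//.
have H : -1 < x / y - 1 by rewrite ltrBDl subrr divr_gt0.
have := le_ln1Dx H; rewrite addrC subrK => {}H.
apply: le_trans (_ : y * (x / y - 1) <= _); first by rewrite ler_pM2l.
by rewrite mulrBr mulr1 mulrC divfK// gt_eqF.
Qed.

Definition xlnx (k : nat) : R := k%:R * lnn k.

(** By convexity the increment of [xlnx] at [m] lies between [ln m + 1] and [ln (m + 1) + 1] for
    [m > 0]; applied at [j] below and at [i] above, the summands 1 cancel. *)
Lemma xlnx_step i j : (i <= j)%N ->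
  lnn j - lnn i.+1 <= (xlnx j.+1 - xlnx j) - (xlnx i.+1 - xlnx i).
Proof.
(* With [ln 0 = 0] the lower bound fails at [m = 0]; there [i = j = 0] and both sides vanish. *)
case: j => [|j] ij.
  by move: ij; rewrite leqn0 => /eqP ->; rewrite subrr ln0// ln1 subrr.
have H1 : xlnx i.+1 - xlnx i <= lnn i.+1 + 1.
  rewrite /xlnx; case: i {ij} => [|i]; first by rewrite mul1r mul0r subr0 lerDl.
  have := @ln_tangent i.+2%:R i.+1%:R (ltr0Sn _ _) (ltr0Sn _ _).
  by rewrite -[i.+2%:R]natr1; lra.
have := @ln_tangent j.+1%:R j.+2%:R (ltr0Sn _ _) (ltr0Sn _ _).
by rewrite {}/xlnx in H1 *; rewrite -[j.+2%:R]natr1; lra.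
Qed.

(** Positions are regrouped by character: the successive occurrences of [a] see the counts 0, 1, 2,
    and so on, and a last character adds one final term to its own sum. *)
Lemma sum_by_char (F : nat -> R) (sigma : nat) (s : seq nat) : all (gtn sigma) s ->
  \sum_(j < size s) F (count_mem (nth 0%N s j) (take j s)) =
  \sum_(a < sigma) \sum_(i < count_mem (a : nat) s) F i.
Proof.
elim/last_ind: s => [|s x IH] H.
  by rewrite big_ord0 big1// => a _; rewrite big_ord0.
move: H; rewrite all_rcons => /andP[/= xs /IH {}IH].
rewrite size_rcons big_ord_recr /= nth_rcons ltnn eqxx -cats1 take_cat ltnn subnn take0 cats0.
under eq_bigr => j _ do rewrite nth_cat take_cat ltn_ord.
rewrite {}IH (bigD1 (Ordinal xs)) //= [in RHS](bigD1 (Ordinal xs)) //=.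
rewrite count_cat /= eqxx addn0 addn1 big_ord_recr /= addrAC; congr (_ + _ + _).
apply: eq_bigr => a; rewrite -val_eqE /= eq_sym => /negPf ax.
by rewrite count_cat /= ax !addn0.
Qed.

(* Counts lag behind by at most [M], so each character pays at most [M] logarithms in total. *)
Lemma sum_ln_window (M N : nat) :
  \sum_(i < N) (lnn i.+1 - lnn (maxn 1 (i.+1 - M))) <= M%:R * lnn N.
Proof.
have E : \sum_(i < N) lnn (maxn 1 (i.+1 - M)) = \sum_(i < N - M) lnn i.+1.
  elim: N => [|N IH]; first by rewrite sub0n !big_ord0.
  rewrite big_ord_recr /= IH; case: (ltnP N M) => NM.
    have -> : (N.+1 - M = 0)%N by lia.
    have -> : (N - M = 0)%N by lia.
    by rewrite big_ord0 maxn0 ln1 addr0.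
  by rewrite subSn// big_ord_recr /=; congr (_ + lnn _); lia.
rewrite big_split /= sumrN E {E}.
(* By cancellation only the last [M] logarithms remain, and raising [M] by one adds at most one
   more, itself at most [lnn N]. *)
elim: M => [|M IH]; first by rewrite subn0 subrr mul0r.
case: (posnP (N - M)) => NM.
  have -> : (N - M.+1 = 0)%N by lia.
  by move: IH; rewrite NM -natr1; have := ln_nat_ge0 N; nra.
have NE : (N - M = (N - M.+1).+1)%N by lia.
move: IH; rewrite NE big_ord_recr /= -NE -natr1.
have : lnn (N - M)%N <= lnn N by apply: ler_ln_nat; exact: leq_subr.
by lra.
Qed.

Lemma sum_decomp n (x : R) (f g h k : nat -> R) :
  \sum_(j < n) (x + f j + (g j - h j) + k j) =
  n%:R * x + \sum_(j < n) f j + (\sum_(j < n) g j - \sum_(j < n) h j) + \sum_(j < n) k j.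
Proof. by rewrite !big_split /= sumrN sumr_const card_ord mulr_natl. Qed.

Section Fixed.
Variables (n sigma : nat) (s : seq nat).
Hypotheses (size_s : size s = n) (s_lt : all (gtn sigma) s) (sigma0 : (0 < sigma)%N).
Let M := blocklen n sigma.
(* The price of reserving 2 units of weight for every character. *)
Let slack : R := lnn M - lnn (M - 2 * sigma).

Let ln2 : 0 < ln 2 :> R. Proof. by rewrite ln_gt0// ltr1n. Qed.
Let M4 : (4 * sigma <= M)%N. Proof. exact: blocklen_alphabet. Qed.

Lemma slack_ge0 : 0 <= slack.
Proof. by rewrite subr_ge0; apply: ler_ln_nat; exact: leq_subr. Qed.

(** The tangent bound gives [(M - 2 sigma) * slack <= 2 sigma], while
    [n <= M^2 <= 2 M (M - 2 sigma)] because [4 sigma <= M]. *)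
Lemma slack_le : n%:R * slack <= (4 * (sigma * M))%:R.
Proof.
have D0 : (0 < M - 2 * sigma)%N by lia.
have Mpos : (0 < M)%N by lia.
have := @ln_tangent M%:R (M - 2 * sigma)%:R; rewrite !ltr0n => /(_ Mpos D0).
rewrite -/slack -natrB; last by lia.
have -> : (M - (M - 2 * sigma) = 2 * sigma)%N by lia.
move=> H; have nM : (n * (2 * sigma) <= 4 * (sigma * M) * (M - 2 * sigma))%N.
  have := blocklen_sq n sigma; rewrite -/M => HM.
  have : (n <= 2 * (M * (M - 2 * sigma)))%N by nia.
  by nia.
rewrite -(ler_pM2r (_ : 0 < (M - 2 * sigma)%:R)) ?ltr0n// -natrM.
apply: le_trans (_ : (n * (2 * sigma))%:R <= _); last by rewrite ler_nat.
rewrite natrM -mulrA ler_wpM2l ?ler0n// mulrC; exact: H.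
Qed.

(** The source of the 2 bits per character: a cell has size below 4 times its dyadic interval. *)
Lemma codelen_ln q i : all (gtn sigma) q -> (i < sigma)%N ->
  (codelen n sigma q i)%:R * ln 2 <= 2 * ln 2 + lnn M - lnn (weight n sigma q i).
Proof.
move=> qs si; have := codelenK n qs si => E.
rewrite [lnn M]ln_nat_exp2 -E natrD.
have /andP[_ hi] := cellexpP n qs i.
have : lnn (weight n sigma q i) <= lnn (2 ^ (2 + cellexp n sigma q i))%N.
  by apply: ler_ln_nat; rewrite expnD; exact: ltnW.
by rewrite ln_nat_exp2 natrD; lra.
Qed.

(** The constant 2 outweighs the loss by flooring, so the weight exceeds
    [(M - 2 sigma) * count / size q]. For count 0, [M <= size q] already suffices. *)
Lemma weight_ln q i : (M <= size q)%N ->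
  lnn M - lnn (weight n sigma q i) <= slack + lnn (size q) - lnn (maxn 1 (count_mem i q)).
Proof.
move=> Mq; have sl := slack_ge0; have MQ := ler_ln_nat Mq.
have w0 := ln_nat_ge0 (weight n sigma q i).
have M0 : (0 < M)%N by lia.
have q0 : (0 < size q)%N by lia.
case: (posnP (count_mem i q)) => [->|c0]; first by rewrite ln1; lra.
have -> : maxn 1 (count_mem i q) = count_mem i q by lia.
have : lnn ((M - 2 * sigma) * count_mem i q)%N <= lnn (weight n sigma q i * size q)%N.
  apply: ler_ln_nat; rewrite /weight -/M mulnDl.
  by apply: ltnW; apply: leq_trans (ltn_ceil _ q0) _; rewrite mulSn; lia.
have D0 : (0 < M - 2 * sigma)%N by lia.
by rewrite !ln_natM// /slack; lra.
Qed.

Lemma position_cost j : (j < n)%N ->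
  let a := nth 0%N s j in let i := count_mem a (take j s) in
  (codelen n sigma (take (stale n sigma j) s) a)%:R * ln 2 <=
  2 * ln 2 + slack + (j < M)%:R * lnn M + (lnn j - lnn i.+1) +
  (lnn i.+1 - lnn (maxn 1 (i.+1 - M))).
Proof.
move=> jn /=; set a := nth _ _ _; set i := count_mem a _.
have aS : (a < sigma)%N by apply: (allP s_lt); rewrite mem_nth// size_s.
have M0 : (0 < M)%N by exact: blocklen_gt0.
have qs : all (gtn sigma) (take (stale n sigma j) s).
  by apply/allP => x /mem_take; exact: (allP s_lt).
apply: le_trans (codelen_ln qs aS) _.
have stj : (stale n sigma j <= j)%N by exact: leq_divM.
have jstM : (j < stale n sigma j + M)%N by rewrite {1}(divn_eq j M) ltn_add2l ltn_pmod.
set q := take _ _ in qs *; have sq : size q = stale n sigma j.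
  by rewrite size_take size_s (leq_ltn_trans stj jn).
have sl := slack_ge0.
have w0 := ln_nat_ge0 (weight n sigma q a); have j0 := ln_nat_ge0 j.
case: (ltnP j M) => jM.
  (* In the first block [i < M], so the last two terms of the bound add up to [lnn j >= 0], and the
     term [(j < M)] pays for the codeword. *)
  have : (i <= j)%N by apply: leq_trans (count_size _ _) _; rewrite size_take; case: ifP; lia.
  move=> ij; have -> : maxn 1 (i.+1 - M) = 1 by lia.
  by rewrite ln1 mul1r; lra.
have Mq : (M <= size q)%N.
  by rewrite sq; apply: leq_pmull; rewrite divn_gt0.
have := weight_ln a Mq.
have : lnn (size q) <= lnn j by apply: ler_ln_nat; rewrite sq.
(* Fewer than [M] characters lie between the block start and [j], so the stale count exceeds
   [i - M]. *)
have : lnn (maxn 1 (i.+1 - M)) <= lnn (maxn 1 (count_mem a q)).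
  apply: ler_ln_nat.
  suff : (i < count_mem a q + M)%N by lia.
  rewrite /i -(subnKC stj) takeD count_cat -/q -addnS leq_add2l.
  apply: leq_ltn_trans (count_size _ _) _; rewrite size_take_min.
  by apply: leq_ltn_trans (geq_minl _ _) _; lia.
by rewrite mul0r; lra.
Qed.

(** [position_cost] is summed with [lnn j - lnn i.+1] replaced by increments of [xlnx]; these
    telescope over positions and, by [sum_by_char], over the occurrences of each character, to what
    [entropy_xlnx] identifies as the entropy. *)
Lemma encode_size_ln :
  (size (encode_upto n sigma s n))%:R * ln 2 <=
  n%:R * (2 * ln 2) + n%:R * slack + M%:R * lnn M +
  (xlnx n - \sum_(a < sigma) xlnx (count_mem (a : nat) s)) + sigma%:R * (M%:R * lnn n).
Proof.
pose c j := count_mem (nth 0%N s j) (take j s).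
apply: (@le_trans _ _ (\sum_(j < n) (2 * ln 2 + slack + (j < M)%:R * lnn M +
   ((xlnx j.+1 - xlnx j) - (xlnx (c j).+1 - xlnx (c j))) +
   (lnn (c j).+1 - lnn (maxn 1 ((c j).+1 - M)))))).
  rewrite size_encode_uptoE natr_sum mulr_suml; apply: ler_sum => j _.
  apply: le_trans (position_cost (ltn_ord j)) _; rewrite lerD2r lerD2l.
  apply: xlnx_step; apply: leq_trans (count_size _ _) _; rewrite size_take.
  by case: ifP; lia.
rewrite (sum_decomp n (2 * ln 2 + slack) (fun j => (j < M)%:R * lnn M)
  (fun j => xlnx j.+1 - xlnx j) (fun j => xlnx (c j).+1 - xlnx (c j))
  (fun j => lnn (c j).+1 - lnn (maxn 1 ((c j).+1 - M)))) /=.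
have -> : \sum_(j < n) (xlnx (c j).+1 - xlnx (c j)) =
    \sum_(a < sigma) xlnx (count_mem (a : nat) s).
  rewrite -[in LHS]size_s (sum_by_char (fun k => xlnx k.+1 - xlnx k) s_lt).
  apply: eq_bigr => a _; rewrite -(big_mkord xpredT (fun k => xlnx k.+1 - xlnx k)).
  by rewrite telescope_sumr// /xlnx mul0r subr0.
have -> : \sum_(j < n) (xlnx j.+1 - xlnx j) = xlnx n.
  by rewrite -(big_mkord xpredT (fun k => xlnx k.+1 - xlnx k)) telescope_sumr// /xlnx mul0r subr0.
have H1 : \sum_(j < n) (j < M)%:R * lnn M <= M%:R * lnn M.
  rewrite -mulr_suml ler_wpM2r ?ln_nat_ge0// -natr_sum ler_nat.
  elim: (n) => [|k IH]; first by rewrite big_ord0.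
  rewrite big_ord_recr /=; case: ltnP => kM; last by rewrite addn0.
  apply: leq_trans (_ : k + 1 <= _)%N; last by rewrite addn1.
  rewrite leq_add2r; apply: leq_trans (_ : \sum_(i < k) 1 <= _)%N.
    by apply: leq_sum => i _; case: (i < M)%N.
  by rewrite sum_nat_const card_ord muln1.
have H2 : \sum_(j < n) (lnn (c j).+1 - lnn (maxn 1 ((c j).+1 - M))) <= sigma%:R * (M%:R * lnn n).
  rewrite -[in leLHS]size_s (sum_by_char (fun k => lnn k.+1 - lnn (maxn 1 (k.+1 - M))) s_lt).
  rewrite mulr_natl -[X in _ *+ X]card_ord -sumr_const; apply: ler_sum => a _.
  apply: le_trans (sum_ln_window _ _) _; rewrite ler_wpM2l ?ler0n//.
  by apply: ler_ln_nat; rewrite -size_s; exact: count_size.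
lra.
Qed.

End Fixed.

Lemma entropy_xlnx n sigma (S : n.-tuple 'I_sigma) :
  n%:R * empirical_entropy R S * ln 2 =
  xlnx n - \sum_(a < sigma) xlnx (count_mem (a : nat) (map val S)).
Proof.
have ln2 : ln 2 != 0 :> R by rewrite gt_eqF// ln_gt0// ltr1n.
have cE (a : 'I_sigma) : count_mem (val a) (map val S) = count_mem a S.
  by rewrite count_map; apply: eq_count => b /=; rewrite val_eqE.
have sumE : \sum_(a < sigma) (count_mem a S)%:R = n%:R :> R.
  rewrite -natr_sum; congr _%:R.
  have s_lt : all (gtn sigma) (map val S) by apply/allP => x /mapP[a _ ->]; exact: ltn_ord.
  have := sum_count_mem s_lt; rewrite size_map size_tuple; apply: etrans.
  by apply: eq_bigr => a _; rewrite cE.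
rewrite /empirical_entropy mulr_sumr mulr_suml /xlnx -sumE mulr_suml sumE -sumrB.
apply: eq_bigr => a _; rewrite cE /lg.
case: (posnP (count_mem a S)) => [->|c0]; first by rewrite !mul0r mulr0 mul0r subrr.
have n0 : (0 < n)%N by apply: leq_trans c0 _; rewrite -{2}(size_tuple S) count_size.
have n0' : n%:R != 0 :> R by rewrite pnatr_eq0 -lt0n.
rewrite ln_div ?posrE ?ltr0n//; field; by rewrite n0' ln2.
Qed.

(* [slack], the first block, and the staleness of the counts each contribute one term. *)
Definition excess (n sigma : nat) : R :=
  sigma%:R * ((blocklen n sigma)%:R * (lnn (blocklen n sigma) + 4 + lnn n)) / ln 2.

Lemma encoding_size n sigma (S : n.-tuple 'I_sigma) :
  (size (encoding block_coder S))%:R <= n%:R * (empirical_entropy R S + 2) + excess n sigma.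
Proof.
have ln2 : 0 < ln 2 :> R by rewrite ln_gt0// ltr1n.
rewrite encoding_block_coder.
have size_s : size (map val S) = n by rewrite size_map size_tuple.
have s_lt : all (gtn sigma) (map val S) by apply/allP => x /mapP[a _ ->]; exact: ltn_ord.
(* An empty alphabet admits only the empty string; otherwise [sigma >= 1] lets the first-block term
   [M ln M] be absorbed into [sigma M ln M]. *)
case: (posnP sigma) => [s0|s0].
  have n0 : n = 0%N.
    by case: n S {size_s s_lt} => // k S; case: (tnth S ord0) => m; rewrite s0.
  have nR : n%:R = 0 :> R by rewrite n0.
  have : (size (encode_upto n sigma (map val S) n) <= 0)%N.
    by apply: leq_trans (size_encode_upto _ _ _ _) _; rewrite n0.
  by rewrite leqn0 => /eqP ->; rewrite nR mul0r add0r /excess s0 !mul0r.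
rewrite -(ler_pM2r ln2); apply: le_trans (encode_size_ln size_s s_lt s0) _.
rewrite -entropy_xlnx [leRHS]mulrDl.
have -> : excess n sigma * ln 2 = sigma%:R * ((blocklen n sigma)%:R *
    (lnn (blocklen n sigma) + 4 + lnn n)) by rewrite /excess divfK// gt_eqF.
have := slack_le size_s s_lt s0.
have : (blocklen n sigma)%:R * lnn (blocklen n sigma) <=
   sigma%:R * ((blocklen n sigma)%:R * lnn (blocklen n sigma)).
  by rewrite ler_peMl ?mulr_ge0 ?ler0n ?ln_nat_ge0// ler1n.
rewrite !natrM; lra.
Qed.

End Redundancy.

(** * Asymptotics *)

Section Asymptotics.
Variables (R : realType) (sigma : nat -> nat).
Hypothesis sigma_small : (fun n : nat => (sigma n)%:R : R^o) =o_\oo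
  (fun n : nat => Num.sqrt n%:R / lg n%:R : R^o).
Local Notation lnn k := (ln ((k)%:R : R)).

Let half_ln2 : 1 / 2 <= ln 2 :> R.
Proof. by have := @ln_tangent R 1 2 ltr01 (ltr0Sn _ _); rewrite ln1; lra. Qed.

Let sigma_ln (eps : R) : 0 < eps ->
  \forall n \near \oo, (sigma n)%:R * lnn n <= eps * ln 2 * Num.sqrt n%:R.
Proof.
move=> eps0; have /eqoP/(_ _ eps0) := sigma_small.
move=> H; near=> n; have n2 : (2 <= n)%N by near: n; exact: nbhs_infty_ge.
have l0 : 0 < lnn n by rewrite ln_gt0// ltr1n.
have : `|(sigma n)%:R : R| <= eps * `|Num.sqrt n%:R / lg n%:R| by near: n.
have l2 : 0 < ln 2 :> R by apply: lt_le_trans half_ln2; lra.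
rewrite /lg !ger0_norm ?ler0n ?divr_ge0 ?sqrtr_ge0 ?(ltW l0) ?(ltW l2)// => Hn.
apply: le_trans (_ : eps * (Num.sqrt n%:R / (lnn n / ln 2)) * lnn n <= _).
  by rewrite ler_pM2r.
rewrite le_eqVlt; apply/orP; left; apply/eqP; field.
by rewrite !lt0r_neq0.
Unshelve. all: by end_near. Qed.

(** [sigma_ln] with [eps = 1] gives [sigma^2 <= n], hence [M^2 <= 68 n + 1]; 81 rounds this up to a
    square for [blocklen_sqrt]. The threshold 256 provides [ln n >= 8 ln 2 >= 4] for
    [excess_littleo]. *)
Let blocklen_small : \forall n \near \oo,
  (256 <= n)%N /\ (blocklen n (sigma n) * blocklen n (sigma n) <= 81 * n)%N.
Proof.
near=> n; have n2 : (256 <= n)%N by near: n; exact: nbhs_infty_ge.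
split => //.
have H : (sigma n)%:R * lnn n <= 1 * ln 2 * Num.sqrt n%:R.
  by near: n; apply: sigma_ln.
have l2 : 0 < ln 2 :> R by apply: lt_le_trans half_ln2; lra.
have : lnn 2 <= lnn n by apply: ler_ln_nat; exact: leq_trans n2.
move=> l2n; have s1 : (sigma n)%:R <= Num.sqrt n%:R :> R.
  by rewrite -(ler_pM2r l2); have := ler0n R (sigma n); nra.
have s2 : (sigma n * sigma n <= n)%N.
  rewrite -(ler_nat R) natrM -[leRHS]sqr_sqrtr ?ler0n// expr2.
  by apply: ler_pM; rewrite ?ler0n.
by have := blocklen_sq_le n (sigma n); lia.
Unshelve. all: by end_near. Qed.

Let blocklen_sqrt n : (blocklen n (sigma n) * blocklen n (sigma n) <= 81 * n)%N ->
  (blocklen n (sigma n))%:R <= 9 * Num.sqrt n%:R :> R.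
Proof.
rewrite -(ler_nat R) !natrM => H.
have := @sqr_sqrtr R n%:R (ler0n _ _); have := @sqrtr_ge0 R n%:R.
move: (Num.sqrt _) H => y H y0 yn; rewrite -yn in H.
by have := ler0n R (blocklen n (sigma n)); nra.
Qed.

Lemma excess_littleo : (fun n => excess R n (sigma n) : R^o) =o_\oo (fun n => n%:R : R^o).
Proof.
apply/eqoP => eps eps0; near=> n.
have [n256 M81] : (256 <= n)%N /\ (blocklen n (sigma n) * blocklen n (sigma n) <= 81 * n)%N.
  by near: n; exact: blocklen_small.
(* Here [27 = 9 * 3]: [M <= 9 sqrt n], and the three summands in [excess] total at most [3 ln n]. *)
have H : (sigma n)%:R * lnn n <= eps / 27 * ln 2 * Num.sqrt n%:R.
  by near: n; apply: sigma_ln; rewrite divr_gt0.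
have l2 : 0 < ln 2 :> R by apply: lt_le_trans half_ln2; lra.
have l256 : 8 * ln 2 <= lnn n.
  by rewrite -[8 * ln 2](ln_nat_exp2 R 8); apply: ler_ln_nat.
have M0 := blocklen_gt0 n (sigma n).
have lM : lnn (blocklen n (sigma n)) <= lnn n.
  apply: ler_ln_nat; have : (blocklen n (sigma n) * blocklen n (sigma n) <= n * n)%N.
    by apply: leq_trans M81 _; rewrite leq_mul2r; apply/orP; right; apply: leq_trans n256.
  by nia.
have MY := blocklen_sqrt M81.
have y2 := @sqr_sqrtr R n%:R (ler0n _ _); have y0 := @sqrtr_ge0 R n%:R.
have lM0 := ln_nat_ge0 R (blocklen n (sigma n)).
have s0 := ler0n R (sigma n); have M0' := ler0n R (blocklen n (sigma n)).
rewrite !ger0_norm ?ler0n//; last first.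
  by rewrite /excess divr_ge0 ?mulr_ge0 ?addr_ge0 ?ln_nat_ge0 ?(ltW l2).
rewrite /excess ler_pdivrMr//.
apply: (@le_trans _ _ ((sigma n)%:R * ((blocklen n (sigma n))%:R * (3 * lnn n)))).
  by apply: ler_wpM2l => //; apply: ler_wpM2l => //; have := half_ln2; lra.
apply: (@le_trans _ _ (9 * Num.sqrt n%:R * (3 * ((sigma n)%:R * lnn n)))).
  have -> : (sigma n)%:R * ((blocklen n (sigma n))%:R * (3 * lnn n)) =
    (blocklen n (sigma n))%:R * (3 * ((sigma n)%:R * lnn n)) by ring.
  by rewrite ler_wpM2r// !mulr_ge0//; lra.
apply: (@le_trans _ _ (9 * Num.sqrt n%:R * (3 * (eps / 27 * ln 2 * Num.sqrt n%:R)))).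
  by rewrite ler_wpM2l ?mulr_ge0// ler_wpM2l.
rewrite -[n%:R in leRHS]y2 le_eqVlt; apply/orP; left; apply/eqP; field.
Unshelve. all: by end_near. Qed.

Lemma time_bigO : (fun n => (time_bound n (sigma n))%:R : R^o) =O_\oo (fun n => n%:R : R^o).
Proof.
(* From [M^2 <= 81 n] follows [M <= 9 n], and [240 * (1 + 9) = 2400]. *)
apply/eqO_exP; exists 2400; first by rewrite ltr0n.
near=> n.
have [n256 M81] : (256 <= n)%N /\ (blocklen n (sigma n) * blocklen n (sigma n) <= 81 * n)%N.
  by near: n; exact: blocklen_small.
rewrite !ger0_norm ?ler0n// -natrM ler_nat /time_bound.
by nia.
Unshelve. all: by end_near. Qed.

End Asymptotics.

Theorem theorem2 (R : realType) :
  exists (A : adaptive_coder) (enc dec : cmd) (c : nat),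
    [/\ (0 < c)%N,
        adaptive_alphabetic_prefix_free A,
        forall (n sigma w : nat) (S : n.-tuple 'I_sigma),
          word_size_ok c w n sigma ->
          exists T : nat,
            encodes_within w enc S (encoding A S) T /\
            decodes_within w dec (encoding A S) S T
      & forall sigma : nat -> nat,
          (fun n : nat => (sigma n)%:R : R^o) =o_\oo
            (fun n : nat => Num.sqrt n%:R / lg n%:R : R^o) ->
          (exists e : nat -> R^o,
             e =o_\oo (fun n : nat => n%:R : R^o) /\
             forall (n : nat) (S : n.-tuple 'I_(sigma n)),
               (size (encoding A S))%:R
                 <= n%:R * (empirical_entropy R S + 2) + e n) /\
          (exists T : nat -> nat,
             (fun n : nat => (T n)%:R : R^o) =O_\oo
               (fun n : nat => n%:R : R^o) /\
             forall (n w : nat) (S : n.-tuple 'I_(sigma n)),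
               word_size_ok c w n (sigma n) ->
               encodes_within w enc S (encoding A S) (T n) /\
               decodes_within w dec (encoding A S) S (T n))].
Proof.
exists block_coder, (coding_prog enc_step), (coding_prog dec_step), 18%N; split => //.
- exact: block_coder_valid.
- move=> n sigma w S /word_size_bounds[large double]; exists (time_bound n sigma); split.
    exact: encodes_block_coder.
  exact: decodes_block_coder.
- move=> sigma small; split.
    exists (fun n => excess R n (sigma n)); split; first exact: excess_littleo.
    by move=> n S; exact: encoding_size.
  exists (fun n => time_bound n (sigma n)); split; first exact: time_bigO.
  move=> n w S /word_size_bounds[large double]; split.
    exact: encodes_block_coder.
  exact: decodes_block_coder.
Qed.
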